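(* Let $p,q\in[2,\infty]$ with $\frac1p+\frac1q<1$ and set $\lambda=\frac{1}{1-\frac1p-\frac1q}$ (i.e. $\lambda=\frac{pq}{pq-p-q}$ for finite $p,q$). Then there is a constant $C\ge1$ such that \[ \Big(\sum_{k=1}^\infty\Big(\sum_{j=1}^\infty|A(e_j,e_k)|^2\Big)^{\frac\lambda2}\Big)^{\frac1\lambda}\le C\|A\| \] for all continuous bilinear forms $A:X_p\times X_q\to\mathbb{K}$. Moreover the exponents are optimal in the following sense: for no $s<\lambda$ is there a constant $C$ with $\big(\sum_k(\sum_j|A(e_j,e_k)|^2)^{s/2}\big)^{1/s}\le C\|A\|$ for all such $A$, and for no $r<2$ is there a constant $C$ with $\big(\sum_k(\sum_j|A(e_j,e_k)|^r)^{\lambda/r}\big)^{1/\lambda}\le C\|A\|$ for all such $A$.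
   Context: $\mathbb{K}$ denotes $\mathbb{R}$ or $\mathbb{C}$. $X_p=\ell_p$ for $p<\infty$ and $X_\infty=c_0$ (similarly for $q$); $e_j$ denote the canonical unit vectors; $1/\infty=0$; $\|A\|=\sup\{|A(x,y)|:\|x\|\le1,\|y\|\le1\}$. *)

(* Defs.v *)
From Stdlib Require Import Reals Lra.
Open Scope R_scope.

Record Scal := {
  car : Type;
  sadd : car -> car -> car;
  smul : car -> car -> car;
  szero : car;
  sone : car;
  sabs : car -> R }.

Definition RS : Scal :=
  {| car := R; sadd := Rplus; smul := Rmult; szero := 0; sone := 1; sabs := Rabs |}.

Definition cmul (z w : R * R) : R * R :=
  (fst z * fst w - snd z * snd w, fst z * snd w + snd z * fst w).
Definition cadd (z w : R * R) : R * R := (fst z + fst w, snd z + snd w).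
Definition cabs (z : R * R) : R := sqrt (fst z * fst z + snd z * snd z).

Definition CS : Scal :=
  {| car := R * R; sadd := cadd; smul := cmul; szero := (0, 0); sone := (1, 0);
     sabs := cabs |}.

Inductive ext := Fin (r : R) | Inf.
Definition einv (p : ext) : R := match p with Fin r => / r | Inf => 0 end.

(* x^a for x >= 0, a > 0, with 0^a = 0 *)
Definition rpow (x a : R) : R := if Rle_dec x 0 then 0 else Rpower x a.

(* ---------- the sequence spaces X_p (= l_p, or c_0 for p = infinity) ---------- *)
Definition seqK (K : Scal) := nat -> car K.

Definition inX {K : Scal} (p : ext) (x : seqK K) : Prop :=
  match p with
  | Fin r => exists l, infinite_sum (fun n => rpow (sabs K (x n)) r) l
  | Inf => Un_cv (fun n => sabs K (x n)) 0
  end.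

Definition in_ball {K : Scal} (p : ext) (x : seqK K) : Prop :=
  inX p x /\
  match p with
  | Fin r => exists l, infinite_sum (fun n => rpow (sabs K (x n)) r) l /\ rpow l (/ r) <= 1
  | Inf => forall n, sabs K (x n) <= 1
  end.

(* canonical unit vectors (indexed from 0) *)
Definition e {K : Scal} (j : nat) : seqK K :=
  fun n => if Nat.eqb n j then sone K else szero K.

Definition lincomb {K : Scal} (a : car K) (x y : seqK K) : seqK K :=
  fun n => sadd K (smul K a (x n)) (y n).

Definition cont_bilinear {K : Scal} (p q : ext) (A : seqK K -> seqK K -> car K) : Prop :=
  (forall a x x' y, inX p x -> inX p x' -> inX q y ->
      A (lincomb a x x') y = sadd K (smul K a (A x y)) (A x' y)) /\
  (forall a x y y', inX p x -> inX q y -> inX q y' ->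
      A x (lincomb a y y') = sadd K (smul K a (A x y)) (A x y')) /\
  (exists M, forall x y, in_ball p x -> in_ball q y -> sabs K (A x y) <= M).

Definition is_opnorm {K : Scal} (p q : ext) (A : seqK K -> seqK K -> car K) (N : R) : Prop :=
  is_lub (fun v => exists x y, in_ball p x /\ in_ball q y /\ v = sabs K (A x y)) N.

Definition mixed_le {K : Scal} (r s : R) (A : seqK K -> seqK K -> car K) (B : R) : Prop :=
  exists (inner : nat -> R) (l : R),
    (forall k, infinite_sum (fun j => rpow (sabs K (A (e j) (e k))) r) (inner k)) /\
    infinite_sum (fun k => rpow (inner k) (s / r)) l /\
    rpow l (/ s) <= B.

(* Main.v *)
Require Import Defs.
From Stdlib Require Import Reals Lra Lia FunctionalExtensionality.
Open Scope R_scope.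

(** Only finite real matrices matter: a complex form is split into real and imaginary
    parts, at the cost of a constant.

    Inequality, [q = oo]: let [s] be conjugate to [p], so [1 <= s <= 2], and let [c_j] be
    the l_2-norms of the rows.  By Khinchine's inequality in the second variable and l_p
    duality, [sum_j c_j^s <= C ||A||^s].  Khinchine's inequality in the first variable at
    the vector [x_j = c_j^(s-1)], normalized in l_p, gives a second bound, and the
    l_s-norm of the l_2-norms [v_k] of the columns lies between the two by Hoelder's
    inequality.  For general [q] apply this to the columns multiplied by [y_k] with [y]
    in the unit ball of l_q; the choice [y_k = v_k^(lambda/q)], normalized in l_q, gives
    the exponent [lambda].

    Optimality: the n x n identity has norm of order at most [n^(1/lambda)] and left-hand
    side [n^(1/s)]; Hadamard matrices have norm of order at most [n^(1/2 + 1/lambda)] and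
    left-hand side [n^(1/r + 1/lambda)]. *)

(** * Powers with nonnegative base *)

Lemma rpow_nonpos x a : x <= 0 -> rpow x a = 0.
Proof. intros H; unfold rpow; destruct (Rle_dec x 0); [reflexivity|lra]. Qed.

Lemma rpow_Rpower x a : 0 < x -> rpow x a = Rpower x a.
Proof. intros H; unfold rpow; destruct (Rle_dec x 0); [lra|reflexivity]. Qed.

Lemma rpow_gt0 x a : 0 < x -> 0 < rpow x a.
Proof. intros H; rewrite rpow_Rpower by assumption; apply exp_pos. Qed.

Lemma rpow_ge0 x a : 0 <= rpow x a.
Proof.
  destruct (Rle_dec x 0) as [H|H].
  - rewrite rpow_nonpos by assumption; lra.
  - apply Rlt_le, rpow_gt0; lra.
Qed.

Lemma rpow_0l a : rpow 0 a = 0.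
Proof. apply rpow_nonpos; lra. Qed.

Lemma rpow_1l a : rpow 1 a = 1.
Proof. rewrite rpow_Rpower by lra; unfold Rpower; rewrite ln_1, Rmult_0_r; apply exp_0. Qed.

Lemma rpow_0r x : 0 < x -> rpow x 0 = 1.
Proof. intros H; rewrite rpow_Rpower by assumption; now apply Rpower_O. Qed.

Lemma rpow_1r x : 0 <= x -> rpow x 1 = x.
Proof.
  intros [H|<-]; [|apply rpow_0l].
  rewrite rpow_Rpower by assumption; now apply Rpower_1.
Qed.

(** The convention that [rpow] vanishes for [x <= 0] makes both sides 0 there, even when
    [a + b = 0]. *)
Lemma rpow_plus x a b : rpow x (a + b) = rpow x a * rpow x b.
Proof.
  destruct (Rle_dec x 0) as [H|H].
  - rewrite !rpow_nonpos by assumption; ring.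
  - rewrite !rpow_Rpower by lra; apply Rpower_plus.
Qed.

Lemma rpow_rpow x a b : rpow (rpow x a) b = rpow x (a * b).
Proof.
  destruct (Rle_dec x 0) as [H|H].
  - rewrite (rpow_nonpos x a), (rpow_nonpos x (a * b)) by assumption; apply rpow_0l.
  - rewrite (rpow_Rpower x a), (rpow_Rpower x (a * b)) by lra.
    rewrite rpow_Rpower by apply exp_pos; apply Rpower_mult.
Qed.

Lemma rpow_mult x y a : 0 <= x -> 0 <= y -> rpow (x * y) a = rpow x a * rpow y a.
Proof.
  intros [Hx|<-] [Hy|<-].
  - rewrite !rpow_Rpower by (try assumption; now apply Rmult_lt_0_compat).
    now rewrite Rpower_mult_distr.
  - rewrite Rmult_0_r, rpow_0l; ring.
  - rewrite Rmult_0_l, rpow_0l; ring.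
  - rewrite Rmult_0_l, rpow_0l; ring.
Qed.

Lemma rpow_2 x : 0 <= x -> rpow x 2 = x * x.
Proof.
  intros H; replace 2 with (1 + 1) by ring; rewrite rpow_plus, rpow_1r by assumption; ring.
Qed.

Lemma rpow_abs_2 x : rpow (Rabs x) 2 = x * x.
Proof. rewrite rpow_2 by apply Rabs_pos; rewrite <- Rabs_mult; apply Rabs_pos_eq; nra. Qed.

Lemma rpow_opp x a : 0 < x -> rpow x a * rpow x (- a) = 1.
Proof. intros H; rewrite <- rpow_plus, Rplus_opp_r; now apply rpow_0r. Qed.

Lemma rpow_le x y a : 0 <= a -> x <= y -> rpow x a <= rpow y a.
Proof.
  intros Ha H; destruct (Rle_dec x 0) as [Hx|Hx].
  - rewrite rpow_nonpos by assumption; apply rpow_ge0.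
  - rewrite !rpow_Rpower by lra; apply Rle_Rpower_l; lra.
Qed.

Lemma rpow_le_1 x a : 0 <= a -> x <= 1 -> rpow x a <= 1.
Proof. intros Ha H; rewrite <- (rpow_1l a); now apply rpow_le. Qed.

Lemma rpow_le_inv x y a : 0 < a -> 0 <= x -> 0 <= y -> rpow x a <= rpow y a -> x <= y.
Proof.
  intros Ha Hx Hy H; apply (rpow_le _ _ (/ a)) in H; [|apply Rlt_le; now apply Rinv_0_lt_compat].
  rewrite !rpow_rpow, Rinv_r, !rpow_1r in H by lra; exact H.
Qed.

Lemma rpow_sqrt x : 0 <= x -> rpow x (/ 2) = sqrt x.
Proof.
  intros [H|<-].
  - rewrite rpow_Rpower by assumption; now apply Rpower_sqrt.
  - now rewrite rpow_0l, sqrt_0.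
Qed.

(** With [d = ln x - ln y] and [m = x^t y^(1-t)], the quotients [x/m] and [y/m] are
    [exp ((1-t) d)] and [exp (- t d)], so [1 + u <= exp u] suffices. *)
Lemma weighted_amgm x y t :
  0 <= t <= 1 -> 0 <= x -> 0 <= y ->
  rpow x t * rpow y (1 - t) <= t * x + (1 - t) * y.
Proof.
  intros Ht [Hx|<-] [Hy|<-]; try (rewrite rpow_0l; nra).
  rewrite !rpow_Rpower by assumption; unfold Rpower.
  set (m := exp (t * ln x) * exp ((1 - t) * ln y)).
  assert (Hm : 0 < m) by (apply Rmult_lt_0_compat; apply exp_pos).
  assert (Ex : x = m * exp ((1 - t) * (ln x - ln y))).
  { unfold m; rewrite <- !exp_plus; rewrite <- (exp_ln x) at 1 by assumption; f_equal; ring. }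
  assert (Ey : y = m * exp (- t * (ln x - ln y))).
  { unfold m; rewrite <- !exp_plus; rewrite <- (exp_ln y) at 1 by assumption; f_equal; ring. }
  set (d := ln x - ln y) in *; clearbody d m.
  pose proof (exp_ineq1_le ((1 - t) * d)) as H1.
  pose proof (exp_ineq1_le (- t * d)) as H2.
  rewrite Ex, Ey.
  apply Rle_trans with (m * (t * (1 + (1 - t) * d) + (1 - t) * (1 + - t * d))); [right; ring|].
  replace (t * (m * exp ((1 - t) * d)) + (1 - t) * (m * exp (- t * d)))
    with (m * (t * exp ((1 - t) * d) + (1 - t) * exp (- t * d))) by ring.
  apply Rmult_le_compat_l; [lra|].
  apply Rplus_le_compat; apply Rmult_le_compat_l; lra.
Qed.

(** * Finite sums *)

(** The index [n] itself is excluded, unlike in [sum_f_R0], so the empty sum exists and inductions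
    start from 0. *)
Fixpoint fsum (n : nat) (f : nat -> R) : R :=
  match n with O => 0 | S n => fsum n f + f n end.

Lemma fsum_ext n f g : (forall i, (i < n)%nat -> f i = g i) -> fsum n f = fsum n g.
Proof.
  induction n as [|n IH]; intros H; simpl; [reflexivity|].
  rewrite IH, H; [reflexivity|lia|intros; apply H; lia].
Qed.

Lemma fsum_le n f g : (forall i, (i < n)%nat -> f i <= g i) -> fsum n f <= fsum n g.
Proof.
  induction n as [|n IH]; intros H; simpl; [lra|].
  apply Rplus_le_compat; [apply IH; intros; apply H; lia|apply H; lia].
Qed.

Lemma fsum_const n c : fsum n (fun _ => c) = INR n * c.
Proof. induction n as [|n IH]; [simpl; ring|rewrite S_INR; simpl; rewrite IH; ring]. Qed.

Lemma fsum_0 n f : (forall i, (i < n)%nat -> f i = 0) -> fsum n f = 0.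
Proof. intros H; rewrite (fsum_ext n f (fun _ => 0)) by assumption; rewrite fsum_const; ring. Qed.

Lemma fsum_ge0 n f : (forall i, (i < n)%nat -> 0 <= f i) -> 0 <= fsum n f.
Proof. intros H; rewrite <- (fsum_0 n (fun _ => 0)) by reflexivity; now apply fsum_le. Qed.

Lemma fsum_sqr_ge0 n f : 0 <= fsum n (fun i => f i * f i).
Proof. apply fsum_ge0; intros; apply Rle_0_sqr. Qed.

Lemma fsum_plus n f g : fsum n (fun i => f i + g i) = fsum n f + fsum n g.
Proof. induction n as [|n IH]; simpl; [ring|rewrite IH; ring]. Qed.

Lemma fsum_minus n f g : fsum n (fun i => f i - g i) = fsum n f - fsum n g.
Proof. induction n as [|n IH]; simpl; [ring|rewrite IH; ring]. Qed.

Lemma fsum_scal n c f : fsum n (fun i => c * f i) = c * fsum n f.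
Proof. induction n as [|n IH]; simpl; [ring|rewrite IH; ring]. Qed.

Lemma fsum_exchange m n (f : nat -> nat -> R) :
  fsum m (fun i => fsum n (fun j => f i j)) = fsum n (fun j => fsum m (fun i => f i j)).
Proof.
  induction m as [|m IH]; simpl.
  - now rewrite fsum_0.
  - now rewrite IH, fsum_plus.
Qed.

Lemma fsum_split m n f : fsum (m + n) f = fsum m f + fsum n (fun i => f (m + i)%nat).
Proof.
  induction n as [|n IH]; simpl.
  - rewrite Nat.add_0_r; ring.
  - rewrite Nat.add_succ_r; simpl; rewrite IH; ring.
Qed.

Lemma fsum_abs n f : Rabs (fsum n f) <= fsum n (fun i => Rabs (f i)).
Proof.
  induction n as [|n IH]; simpl; [rewrite Rabs_R0; lra|].
  eapply Rle_trans; [apply Rabs_triang|lra].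
Qed.

Lemma fsum_incl m n f : (m <= n)%nat -> (forall i, 0 <= f i) -> fsum m f <= fsum n f.
Proof.
  intros H Hf; replace n with (m + (n - m))%nat by lia; rewrite fsum_split.
  pose proof (fsum_ge0 (n - m) (fun i => f (m + i)%nat) ltac:(intros; apply Hf)); lra.
Qed.

Lemma fsum_term n f k : (k < n)%nat -> (forall i, (i < n)%nat -> 0 <= f i) -> f k <= fsum n f.
Proof.
  induction n as [|n IH]; intros H Hf; [lia|simpl].
  destruct (Nat.eq_dec k n) as [->|Hk].
  - pose proof (fsum_ge0 n f ltac:(intros; apply Hf; lia)); lra.
  - pose proof (IH ltac:(lia) ltac:(intros; apply Hf; lia)).
    pose proof (Hf n ltac:(lia)); lra.
Qed.

Lemma fsum_eq0 n f k :
  (forall i, (i < n)%nat -> 0 <= f i) -> fsum n f <= 0 -> (k < n)%nat -> f k = 0.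
Proof. intros Hf H Hk; pose proof (fsum_term n f k Hk Hf); pose proof (Hf k Hk); lra. Qed.

Lemma fsum_single n k f :
  (k < n)%nat -> (forall i, (i < n)%nat -> i <> k -> f i = 0) -> fsum n f = f k.
Proof.
  induction n as [|n IH]; intros Hk H; [lia|simpl].
  destruct (Nat.eq_dec k n) as [->|Hn].
  - rewrite fsum_0; [ring|]; intros i Hi; apply H; lia.
  - rewrite IH, (H n) by (try lia; intros; apply H; lia); ring.
Qed.

Lemma fsum_trunc m n f :
  (m <= n)%nat -> (forall i, (m <= i)%nat -> f i = 0) -> fsum n f = fsum m f.
Proof.
  intros H Hf; replace n with (m + (n - m))%nat by lia.
  rewrite fsum_split, (fsum_0 (n - m)); [ring|]; intros; apply Hf; lia.
Qed.

Lemma sum_f_R0_fsum f n : sum_f_R0 f n = fsum (S n) f.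
Proof. induction n as [|n IH]; simpl in *; [ring|now rewrite IH]. Qed.

(** Weighted AM-GM is applied to the terms divided by [U = fsum n u] and [V = fsum n v]; the
    resulting bounds add up to [t + (1 - t) = 1]. If one of the two sums vanishes, so does every
    term on the left. *)
Lemma holder n u v t :
  0 <= t <= 1 ->
  (forall i, (i < n)%nat -> 0 <= u i) -> (forall i, (i < n)%nat -> 0 <= v i) ->
  fsum n (fun i => rpow (u i) t * rpow (v i) (1 - t))
  <= rpow (fsum n u) t * rpow (fsum n v) (1 - t).
Proof.
  intros Ht Hu Hv.
  pose proof (fsum_ge0 n u Hu) as HU; pose proof (fsum_ge0 n v Hv) as HV.
  assert (Hz : 0 <= rpow (fsum n u) t * rpow (fsum n v) (1 - t))
    by (apply Rmult_le_pos; apply rpow_ge0).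
  destruct (Rle_dec (fsum n u) 0) as [HU0|HU0].
  { rewrite fsum_0; [exact Hz|]; intros i Hi.
    rewrite (fsum_eq0 n u i), rpow_0l by assumption; ring. }
  destruct (Rle_dec (fsum n v) 0) as [HV0|HV0].
  { rewrite fsum_0; [exact Hz|]; intros i Hi.
    rewrite (fsum_eq0 n v i), (rpow_0l (1 - t)) by assumption; ring. }
  set (U := fsum n u) in *; set (V := fsum n v) in *.
  apply Rle_trans with
    (fsum n (fun i => rpow U t * rpow V (1 - t) * (t / U * u i + (1 - t) / V * v i))).
  - apply fsum_le; intros i Hi.
    pose proof (weighted_amgm (u i / U) (v i / V) t Ht
      ltac:(apply Rle_mult_inv_pos; [now apply Hu|lra])
      ltac:(apply Rle_mult_inv_pos; [now apply Hv|lra])) as H.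
    replace (rpow (u i) t) with (rpow U t * rpow (u i / U) t).
    2:{ rewrite <- rpow_mult; [f_equal; field; lra|lra|apply Rle_mult_inv_pos; [now apply Hu|lra]]. }
    replace (rpow (v i) (1 - t)) with (rpow V (1 - t) * rpow (v i / V) (1 - t)).
    2:{ rewrite <- rpow_mult; [f_equal; field; lra|lra|apply Rle_mult_inv_pos; [now apply Hv|lra]]. }
    replace (t / U * u i + (1 - t) / V * v i) with (t * (u i / U) + (1 - t) * (v i / V)) by (field; lra).
    apply Rle_trans with (rpow U t * rpow V (1 - t) * (rpow (u i / U) t * rpow (v i / V) (1 - t))).
    + right; ring.
    + apply Rmult_le_compat_l; assumption.
  - rewrite fsum_scal, fsum_plus, !fsum_scal; fold U V.
    right; field; lra.
Qed.

(** * Khinchine's inequality *)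

Definition upd (eps : nat -> R) (n : nat) (c : R) : nat -> R :=
  fun k => if Nat.eqb k n then c else eps k.

Definition signs (eps : nat -> R) : Prop := forall k, eps k = 1 \/ eps k = -1.

Lemma signs_upd eps n c : signs eps -> c = 1 \/ c = -1 -> signs (upd eps n c).
Proof. intros He Hc k; unfold upd; destruct (Nat.eqb k n); auto. Qed.

(** The expectation over independent uniform signs at the positions below [n]; all other positions
    keep the sign 1. The recursion exposes the last sign, which is what the moment computations
    use. *)
Fixpoint sign_mean (n : nat) (F : (nat -> R) -> R) : R :=
  match n with
  | O => F (fun _ => 1)
  | S n => (sign_mean n (fun eps => F (upd eps n 1))
            + sign_mean n (fun eps => F (upd eps n (-1)))) / 2
  end.

Lemma sign_mean_le n F G :
  (forall eps, signs eps -> F eps <= G eps) -> sign_mean n F <= sign_mean n G.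
Proof.
  revert F G; induction n as [|n IH]; intros F G H; simpl.
  - apply H; intros k; now left.
  - pose proof (IH (fun eps => F (upd eps n 1)) (fun eps => G (upd eps n 1))
      ltac:(intros eps He; apply H, signs_upd; auto)).
    pose proof (IH (fun eps => F (upd eps n (-1))) (fun eps => G (upd eps n (-1)))
      ltac:(intros eps He; apply H, signs_upd; auto)).
    lra.
Qed.

Lemma sign_mean_ext n F G : (forall eps, F eps = G eps) -> sign_mean n F = sign_mean n G.
Proof. intros H; f_equal; now apply functional_extensionality. Qed.

Lemma sign_mean_plus n F G :
  sign_mean n (fun eps => F eps + G eps) = sign_mean n F + sign_mean n G.
Proof.
  revert F G; induction n as [|n IH]; intros F G; simpl; [reflexivity|].
  rewrite (IH (fun eps => F (upd eps n 1))), (IH (fun eps => F (upd eps n (-1)))); field.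
Qed.

Lemma sign_mean_scal n c F : sign_mean n (fun eps => c * F eps) = c * sign_mean n F.
Proof.
  revert F; induction n as [|n IH]; intros F; simpl; [reflexivity|].
  rewrite (IH (fun eps => F (upd eps n 1))), (IH (fun eps => F (upd eps n (-1)))); field.
Qed.

Lemma sign_mean_const n c : sign_mean n (fun _ => c) = c.
Proof. induction n as [|n IH]; simpl; [reflexivity|rewrite IH; field]. Qed.

Lemma sign_mean_fsum n m (F : nat -> (nat -> R) -> R) :
  sign_mean n (fun eps => fsum m (fun i => F i eps)) = fsum m (fun i => sign_mean n (F i)).
Proof.
  induction m as [|m IH]; simpl; [apply sign_mean_const|].
  now rewrite (sign_mean_plus n (fun eps => fsum m (fun i => F i eps)) (F m)), IH.
Qed.

Lemma fsum_upd n eps b c :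
  fsum (S n) (fun k => upd eps n c k * b k) = fsum n (fun k => eps k * b k) + c * b n.
Proof.
  simpl; unfold upd at 2; rewrite Nat.eqb_refl; f_equal.
  apply fsum_ext; intros k Hk; unfold upd.
  destruct (Nat.eqb_spec k n); [lia|reflexivity].
Qed.

(** Cross terms cancel: [(S + b)^2 + (S - b)^2 = 2 S^2 + 2 b^2]. *)
Lemma sign_mean_square n b :
  sign_mean n (fun eps => (fsum n (fun k => eps k * b k)) ^ 2) = fsum n (fun k => b k * b k).
Proof.
  induction n as [|n IH]; [simpl; ring|].
  cbn [sign_mean].
  rewrite <- sign_mean_plus.
  rewrite (sign_mean_ext n _
    (fun eps => 2 * (fsum n (fun k => eps k * b k)) ^ 2 + 2 * (b n * b n)))
    by (intros eps; rewrite !fsum_upd; ring).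
  rewrite sign_mean_plus, sign_mean_scal, sign_mean_const, IH; simpl; field.
Qed.

(** Odd powers of the last sign cancel, [(S + b)^4 + (S - b)^4 = 2 S^4 + 12 b^2 S^2 + 2 b^4], and
    the induction closes because [3 V^2 + 6 b^2 V + b^4 <= 3 (V + b^2)^2]. *)
Lemma sign_mean_fourth n b :
  sign_mean n (fun eps => (fsum n (fun k => eps k * b k)) ^ 4)
  <= 3 * (fsum n (fun k => b k * b k)) ^ 2.
Proof.
  induction n as [|n IH]; [simpl; lra|].
  cbn [sign_mean].
  rewrite <- sign_mean_plus.
  rewrite (sign_mean_ext n _
    (fun eps => 2 * (fsum n (fun k => eps k * b k)) ^ 4 +
       (12 * (b n * b n) * (fsum n (fun k => eps k * b k)) ^ 2 + 2 * (b n * b n) ^ 2)))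
    by (intros eps; rewrite !fsum_upd; ring).
  rewrite !sign_mean_plus, !sign_mean_scal, sign_mean_const, sign_mean_square.
  cbn [fsum]; nra.
Qed.

(** The left side is a polynomial whose mean is controlled by second and fourth moments. It lies
    below [t^2] for [t <= 1] and below [t] beyond; [4 / 27] is the least coefficient for the latter,
    with contact at [t = 3 / 2]. *)
Lemma rpow_ge_quartic t s : 1 <= s <= 2 -> 0 <= t -> t ^ 2 - 4 / 27 * t ^ 4 <= rpow t s.
Proof.
  intros Hs Ht; destruct (Rle_dec t 1) as [H1|H1].
  - apply Rle_trans with (t * t); [nra|].
    rewrite <- rpow_2 by assumption.
    replace 2 with (s + (2 - s)) by ring; rewrite rpow_plus.
    rewrite <- (Rmult_1_r (rpow t s)) at 2.
    apply Rmult_le_compat_l; [apply rpow_ge0|apply rpow_le_1; lra].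
  - apply Rle_trans with t.
    (* This product equals [t - t^2 + 4 / 27 t^4]. *)
    + assert (0 <= t * (4 / 27 * (t - 3 / 2) ^ 2 * (t + 3))).
      { apply Rmult_le_pos; [lra|]; apply Rmult_le_pos; [|lra].
        apply Rmult_le_pos; [lra|apply pow2_ge_0]. }
      nra.
    + replace s with (1 + (s - 1)) by ring; rewrite rpow_plus, rpow_1r by assumption.
      rewrite <- (Rmult_1_r t) at 1; apply Rmult_le_compat_l; [lra|].
      rewrite <- (rpow_1l (s - 1)) at 1; apply rpow_le; lra.
Qed.

(** The mean of [rpow_ge_quartic] at [|S|/sigma], [S] the random sum and [sigma^2] its
    variance, is at least [1 - 3 * 4/27 = 5/9]. *)
Lemma khinchine n b s :
  1 <= s <= 2 ->
  5 / 9 * rpow (fsum n (fun k => b k * b k)) (s / 2)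
  <= sign_mean n (fun eps => rpow (Rabs (fsum n (fun k => eps k * b k))) s).
Proof.
  intros Hs; set (V := fsum n (fun k => b k * b k)).
  destruct (Rle_dec V 0) as [HV|HV].
  { rewrite (rpow_nonpos V) by assumption; rewrite Rmult_0_r.
    rewrite <- (sign_mean_const n 0); apply sign_mean_le; intros; apply rpow_ge0. }
  pose proof (sqrt_lt_R0 V ltac:(lra)) as Hsg.
  pose proof (sqrt_sqrt V ltac:(lra)) as Hss.
  set (sg := sqrt V) in *.
  assert (E : rpow V (s / 2) = rpow sg s).
  { unfold sg; rewrite <- rpow_sqrt, rpow_rpow by lra; f_equal; field. }
  rewrite E.
  (* The pointwise quartic bound multiplied by [sg^s], where [sg^2 = V]; only second and fourth
     moments remain to be estimated. *)
  apply Rle_trans with (sign_mean n (fun eps =>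
    rpow sg s / V * (fsum n (fun k => eps k * b k)) ^ 2 +
    - (4 / 27 * (rpow sg s / V ^ 2)) * (fsum n (fun k => eps k * b k)) ^ 4)).
  - rewrite sign_mean_plus, !sign_mean_scal, sign_mean_square.
    pose proof (sign_mean_fourth n b) as H4; fold V in H4 |- *.
    set (Q := sign_mean n (fun eps => fsum n (fun k => eps k * b k) ^ 4)) in *.
    pose proof (rpow_gt0 sg s Hsg).
    assert (0 < rpow sg s / V ^ 2) by (apply Rdiv_lt_0_compat; [assumption|nra]).
    apply Rle_trans with (rpow sg s / V * V + - (4 / 27 * (rpow sg s / V ^ 2)) * (3 * V ^ 2)).
    + right; field; lra.
    + nra.
  - apply sign_mean_le; intros eps _.
    set (S := fsum n (fun k => eps k * b k)).
    assert (Ht : 0 <= Rabs S / sg) by (apply Rle_mult_inv_pos; [apply Rabs_pos|assumption]).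
    pose proof (rpow_ge_quartic (Rabs S / sg) s Hs Ht) as H.
    replace (rpow (Rabs S) s) with (rpow sg s * rpow (Rabs S / sg) s).
    2:{ rewrite <- rpow_mult by lra; f_equal; field; lra. }
    assert (E2 : (Rabs S / sg) ^ 2 = S ^ 2 / V).
    { rewrite <- Hss; unfold Rdiv; rewrite Rpow_mult_distr, pow2_abs; field; lra. }
    replace ((Rabs S / sg) ^ 4) with (((Rabs S / sg) ^ 2) ^ 2) in H by ring.
    rewrite E2 in H.
    apply Rle_trans with (rpow sg s * (S ^ 2 / V - 4 / 27 * (S ^ 2 / V) ^ 2)).
    + right; field; lra.
    + apply Rmult_le_compat_l; [apply rpow_ge0|assumption].
Qed.

(** * The inequality for finite real matrices *)

(** Literally the form of the theorem's hypotheses on [p] and [q], which are therefore passed on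
    unchanged. *)
Definition admissible (p : ext) : Prop := match p with Fin r => 2 <= r | Inf => True end.

Lemma einv_bounds p : admissible p -> 0 <= einv p <= / 2.
Proof.
  destruct p as [r|]; simpl; intros H; [|lra].
  split; [apply Rlt_le, Rinv_0_lt_compat; lra|apply Rinv_le_contravar; lra].
Qed.

(** The unit ball of l_p in dimension [n]. For finite [p] the root is dropped, since the bound is
    1. *)
Definition fball (p : ext) (n : nat) (x : nat -> R) : Prop :=
  match p with
  | Fin r => fsum n (fun j => rpow (Rabs (x j)) r) <= 1
  | Inf => forall j, (j < n)%nat -> Rabs (x j) <= 1
  end.

Lemma fball_le p n x y :
  admissible p -> fball p n x -> (forall j, (j < n)%nat -> Rabs (y j) <= Rabs (x j)) ->
  fball p n y.
Proof.
  destruct p as [r|]; simpl; intros Hp Hx H.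
  - eapply Rle_trans; [|exact Hx]; apply fsum_le; intros; apply rpow_le; [lra|auto].
  - intros j Hj; eapply Rle_trans; [apply H|apply Hx]; assumption.
Qed.

(** For finite [p] the p-th powers of the entries are [t_j^m / T], which sum to 1. These are the
    test vectors of the duality and weighting arguments below. For [p = Inf] both exponents are 0,
    and since [rpow 0 0 = 0] the entries are 0 or 1. *)
Lemma fball_normalized p n t m :
  admissible p -> 0 <= m -> (forall j, 0 <= t j) ->
  let T := fsum n (fun j => rpow (t j) m) in
  0 < T -> fball p n (fun j => rpow (t j) (m * einv p) * rpow T (- einv p)).
Proof.
  intros Hp Hm Ht T HT; destruct p as [r|]; simpl in *.
  - rewrite (fsum_ext _ _ (fun j => rpow T (- 1) * rpow (t j) m)).
    + rewrite fsum_scal; fold T.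
      rewrite <- (rpow_1r T) at 2 by lra; rewrite Rmult_comm, rpow_opp by assumption; lra.
    + intros j Hj; rewrite Rabs_pos_eq by (apply Rmult_le_pos; apply rpow_ge0).
      rewrite rpow_mult, !rpow_rpow by apply rpow_ge0.
      rewrite Rmult_comm; f_equal; f_equal; field; lra.
  - intros j Hj; rewrite Rabs_pos_eq by (apply Rmult_le_pos; apply rpow_ge0).
    rewrite Rmult_0_r, Ropp_0, (rpow_0r T) by assumption.
    rewrite Rmult_1_r; destruct (Ht j) as [H|<-]; [rewrite rpow_0r; lra|rewrite rpow_0l; lra].
Qed.

Definition conj_exp (p : ext) : R := / (1 - einv p).

Lemma conj_exp_bounds p : admissible p -> 1 <= conj_exp p <= 2.
Proof.
  intros H; apply einv_bounds in H; unfold conj_exp; split.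
  - rewrite <- Rinv_1; apply Rinv_le_contravar; lra.
  - rewrite <- (Rinv_inv 2); apply Rinv_le_contravar; lra.
Qed.

(** The identity [s/p = s - 1] for conjugate exponents, in a form that linear arithmetic can use. *)
Lemma conj_exp_einv p : admissible p -> conj_exp p * einv p = conj_exp p - 1.
Proof. intros H; apply einv_bounds in H; unfold conj_exp; field; lra. Qed.

(** The extremal vector [sign(z_j) |z_j|^(s/p) Z^(-1/p)], with [s = conj_exp p] and [Z] the sum on
    the left, turns the hypothesis into [Z^(1 - 1/p) <= M]; the claim is the power [s] of this. *)
Lemma lp_duality p n z M :
  admissible p -> 0 <= M ->
  (forall x, fball p n x -> Rabs (fsum n (fun j => x j * z j)) <= M) ->
  fsum n (fun j => rpow (Rabs (z j)) (conj_exp p)) <= rpow M (conj_exp p).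
Proof.
  intros Hp HM H; pose proof (conj_exp_bounds p Hp) as Hs.
  pose proof (conj_exp_einv p Hp) as Hse; pose proof (einv_bounds p Hp) as He.
  set (s := conj_exp p) in *; set (Z := fsum n (fun j => rpow (Rabs (z j)) s)).
  destruct (Rle_dec Z 0) as [HZ|HZ]; [pose proof (rpow_ge0 M s); lra|].
  pose proof (fball_normalized p n (fun j => Rabs (z j)) s Hp ltac:(lra)
    ltac:(intros; apply Rabs_pos)) as HB; cbv zeta beta in HB; fold Z in HB.
  specialize (HB ltac:(lra)).
  (* The sign of 0 is taken to be 1, so that [Rabs (sg t) = 1] always. *)
  pose (sg := fun t : R => if Rle_dec 0 t then 1 else -1).
  assert (Hsg : forall t, sg t * t = Rabs t /\ Rabs (sg t) = 1).
  { intros t; unfold sg; destruct (Rle_dec 0 t).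
    - rewrite (Rabs_pos_eq t), Rabs_R1 by assumption; split; ring.
    - rewrite (Rabs_left t), (Rabs_left (-1)) by lra; split; ring. }
  specialize (H (fun j => sg (z j) * (rpow (Rabs (z j)) (s * einv p) * rpow Z (- einv p)))).
  assert (HF : fball p n (fun j => sg (z j) * (rpow (Rabs (z j)) (s * einv p) * rpow Z (- einv p)))).
  { eapply fball_le; [exact Hp|exact HB|]; intros j _; cbv beta.
    rewrite Rabs_mult, (proj2 (Hsg _)); lra. }
  specialize (H HF).
  rewrite (fsum_ext _ _ (fun j => rpow Z (- einv p) * rpow (Rabs (z j)) s)) in H.
  2:{ intros j _; rewrite Hse.
      replace (rpow (Rabs (z j)) s) with (rpow (Rabs (z j)) (s - 1) * Rabs (z j)).
      - rewrite <- (proj1 (Hsg (z j))) at 3; ring.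
      - rewrite <- (rpow_1r (Rabs (z j))) at 2 by apply Rabs_pos.
        rewrite <- rpow_plus; f_equal; ring. }
  rewrite fsum_scal in H; fold Z in H.
  rewrite Rabs_pos_eq in H by (apply Rmult_le_pos; [apply rpow_ge0|lra]).
  rewrite <- (rpow_1r Z) in H at 2 by lra; rewrite <- rpow_plus in H.
  apply (rpow_le _ _ s) in H; [|lra]; rewrite rpow_rpow in H.
  replace ((- einv p + 1) * s) with 1 in H by lra.
  rewrite rpow_1r in H by lra; exact H.
Qed.

(** * Bilinear forms of real matrices *)

Definition bform (n : nat) (a : nat -> nat -> R) (x y : nat -> R) : R :=
  fsum n (fun j => fsum n (fun k => a j k * x j * y k)).

Lemma bform_rows n a x y :
  bform n a x y = fsum n (fun j => x j * fsum n (fun k => a j k * y k)).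
Proof.
  apply fsum_ext; intros j _; rewrite <- fsum_scal; apply fsum_ext; intros; ring.
Qed.

Lemma bform_cols n a x y :
  bform n a x y = fsum n (fun k => y k * fsum n (fun j => x j * a j k)).
Proof.
  unfold bform; rewrite fsum_exchange; apply fsum_ext; intros k _.
  rewrite <- fsum_scal; apply fsum_ext; intros; ring.
Qed.

Lemma signs_abs eps k : signs eps -> Rabs (eps k) = 1.
Proof. intros H; destruct (H k) as [-> | ->]; unfold Rabs; destruct Rcase_abs; lra. Qed.

(** Khinchine's inequality is applied for each [j], and the sum over [j] is moved inside the mean,
    which is at most the uniform bound [M]. The factor is the inverse of [5 / 9]. *)
Lemma khinchine_family n (b : nat -> nat -> R) s M :
  1 <= s <= 2 ->
  (forall eps, signs eps ->
     fsum n (fun j => rpow (Rabs (fsum n (fun k => eps k * b j k))) s) <= M) ->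
  fsum n (fun j => rpow (fsum n (fun k => b j k * b j k)) (s / 2)) <= 9 / 5 * M.
Proof.
  intros Hs H.
  assert (H2 : fsum n (fun j => 5 / 9 * rpow (fsum n (fun k => b j k * b j k)) (s / 2)) <= M).
  { eapply Rle_trans; [apply fsum_le; intros j _; apply (khinchine n (b j) s Hs)|].
    rewrite <- (sign_mean_fsum n n
      (fun j eps => rpow (Rabs (fsum n (fun k => eps k * b j k))) s)).
    rewrite <- (sign_mean_const n M); apply sign_mean_le; exact H. }
  rewrite fsum_scal in H2; lra.
Qed.

(** The power of Khinchine's [9 / 5] collected in [mixed_bound_c0]: exponent [2 - s] from the
    average in the first variable, and [(s - 1) * (2 - s) / s + (s - 1)] from the power of [Z]. *)
Definition mixed_const (s : R) : R := rpow (9 / 5) (1 + (s - 1) * (2 - s) / s).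

(** The case [q = oo], with [s] conjugate to [p].  Averaging over signs in the second
    variable bounds [Z], the sum of [c_j^s] for the row norms [c_j]; averaging over signs in
    the first variable at [x_j = c_j^(s-1) Z^(-1/p)] bounds the sum of [U_k^(1/2)], where
    [U_k = sum_j c_j^(2s-2) b_jk^2].  Since [V_k = sum_j c_j^(s-2) b_jk^2] sums to [Z],
    two applications of Hoelder's inequality interpolate the column norms. *)
Lemma mixed_bound_c0 p n b M :
  admissible p -> 0 <= M ->
  (forall x y, fball p n x -> fball Inf n y -> Rabs (bform n b x y) <= M) ->
  fsum n (fun k => rpow (fsum n (fun j => b j k * b j k)) (conj_exp p / 2))
  <= mixed_const (conj_exp p) * rpow M (conj_exp p).
Proof.
  intros Hp HM H; pose proof (conj_exp_bounds p Hp) as Hs.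
  pose proof (conj_exp_einv p Hp) as Hse; pose proof (einv_bounds p Hp) as He.
  pose proof (fun z => lp_duality p n z M Hp HM) as Hdual.
  set (s := conj_exp p) in *.
  set (c := fun j => sqrt (fsum n (fun k => b j k * b j k))).
  assert (Hc0 : forall j, 0 <= fsum n (fun k => b j k * b j k))
    by (intros; apply fsum_sqr_ge0).
  assert (Hc : forall j, 0 <= c j) by (intros; apply sqrt_pos).
  assert (Hcc : forall j, rpow (c j) s = rpow (fsum n (fun k => b j k * b j k)) (s / 2)).
  { intros j; unfold c; rewrite <- rpow_sqrt, rpow_rpow by apply Hc0; f_equal; field. }
  set (Z := fsum n (fun j => rpow (c j) s)).
  (* For fixed signs in the second variable, duality in the first bounds an l_s sum; then the signs
     are averaged. *)
  assert (HZ1 : Z <= 9 / 5 * rpow M s).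
  { unfold Z; rewrite (fsum_ext _ _ _ (fun j _ => Hcc j)).
    apply khinchine_family; [exact Hs|]; intros eps Heps.
    apply Hdual; intros x Hx.
    replace (fsum n (fun j => x j * fsum n (fun k => eps k * b j k))) with (bform n b x eps).
    - apply H; [exact Hx|]; intros k _; rewrite signs_abs by assumption; lra.
    - rewrite bform_rows; apply fsum_ext; intros j _; f_equal; apply fsum_ext; intros; ring. }
  (* If [Z] vanishes, every row vanishes, hence every column. *)
  destruct (Rle_dec Z 0) as [HZ0|HZ0].
  { rewrite fsum_0; [apply Rmult_le_pos; apply rpow_ge0|]; intros k Hk.
    rewrite fsum_0; [apply rpow_0l|]; intros j Hj.
    assert (Hr : rpow (fsum n (fun k => b j k * b j k)) (s / 2) = 0).
    { rewrite <- Hcc; apply (fsum_eq0 n (fun j => rpow (c j) s)); auto.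
      intros; apply rpow_ge0. }
    apply (fsum_eq0 n (fun k => b j k * b j k)); [intros; nra| |assumption].
    destruct (Rle_dec (fsum n (fun k => b j k * b j k)) 0) as [Hn|Hn]; [assumption|].
    pose proof (rpow_gt0 (fsum n (fun k => b j k * b j k)) (s / 2) ltac:(lra)); lra. }
  set (x := fun j => rpow (c j) (s * einv p) * rpow Z (- einv p)).
  assert (Hx : fball p n x) by (apply fball_normalized; auto; fold Z; lra).
  set (U := fun k => fsum n (fun j => rpow (c j) (2 * s - 2) * (b j k * b j k))).
  set (V := fun k => fsum n (fun j => rpow (c j) (s - 2) * (b j k * b j k))).
  assert (HU0 : forall k, 0 <= U k).
  { intros; apply fsum_ge0; intros; apply Rmult_le_pos; [apply rpow_ge0|nra]. }
  assert (HV0 : forall k, 0 <= V k).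
  { intros; apply fsum_ge0; intros; apply Rmult_le_pos; [apply rpow_ge0|nra]. }
  (* For fixed signs in the first variable, [eps_j x_j] stays in the unit ball, and duality with
     [Inf], whose conjugate exponent is 1, bounds an l_1 sum. After averaging, the factor [Z^(-1/p)]
     of [x] is moved to the right. *)
  assert (HU : fsum n (fun k => rpow (U k) (/ 2)) <= 9 / 5 * M * rpow Z (einv p)).
  { assert (H2 : fsum n (fun k => rpow (fsum n (fun j => (x j * b j k) * (x j * b j k))) (1 / 2))
                 <= 9 / 5 * M).
    { apply (khinchine_family n (fun k j => x j * b j k) 1 M); [lra|]; intros eps Heps.
      pose proof (lp_duality Inf n (fun k => fsum n (fun j => eps j * (x j * b j k))) M I HM) as HD.
      replace (conj_exp Inf) with 1 in HD by (unfold conj_exp; simpl; field).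
      rewrite (rpow_1r M) in HD by assumption; apply HD; intros y Hy.
      replace (fsum n (fun k => y k * fsum n (fun j => eps j * (x j * b j k))))
        with (bform n b (fun j => eps j * x j) y).
      - apply H; [|exact Hy].
        apply (fball_le p n x); auto; intros j _.
        rewrite Rabs_mult, signs_abs by assumption; lra.
      - rewrite bform_cols; apply fsum_ext; intros k _; f_equal; apply fsum_ext; intros; ring. }
    rewrite (fsum_ext _ _ (fun k => rpow Z (- einv p) * rpow (U k) (/ 2))) in H2.
    - rewrite fsum_scal in H2.
      apply (Rmult_le_compat_l (rpow Z (einv p))) in H2; [|apply rpow_ge0].
      rewrite <- Rmult_assoc, rpow_opp, Rmult_1_l in H2 by lra; lra.
    - intros k _.
      replace (fsum n (fun j => x j * b j k * (x j * b j k)))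
        with (rpow Z (- (2 * einv p)) * U k).
      + rewrite rpow_mult, rpow_rpow by (apply rpow_ge0 || apply HU0).
        f_equal; f_equal; lra.
      + unfold U; rewrite <- fsum_scal; apply fsum_ext; intros j _; unfold x.
        replace (- (2 * einv p)) with (- einv p + - einv p) by ring.
        replace (2 * s - 2) with (s * einv p + s * einv p) by lra.
        rewrite !rpow_plus; ring. }
  assert (HV : fsum n V = Z).
  { unfold V; rewrite fsum_exchange; apply fsum_ext; intros j _.
    rewrite fsum_scal.
    replace (fsum n (fun k => b j k * b j k)) with (rpow (c j) 2).
    - rewrite <- rpow_plus; f_equal; ring.
    - rewrite rpow_2 by auto; unfold c; now apply sqrt_sqrt. }
  (* The Hoelder weight [theta = 2 / s - 1] is the one for which the powers of [c_j] cancel: [(2 s -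
     2) theta + (s - 2) (1 - theta) = 0]. *)
  assert (Hth : 0 <= 2 / s - 1 <= 1).
  { split.
    - apply Rmult_le_reg_r with s; [lra|]; unfold Rdiv; rewrite Rmult_0_l.
      replace ((2 * / s - 1) * s) with (2 - s) by (field; lra); lra.
    - apply Rmult_le_reg_r with s; [lra|].
      replace ((2 / s - 1) * s) with (2 - s) by (field; lra); lra. }
  assert (HW : forall k, (k < n)%nat ->
    rpow (fsum n (fun j => b j k * b j k)) (s / 2)
    <= rpow (rpow (U k) (/ 2)) (2 - s) * rpow (V k) (1 - (2 - s))).
  { intros k Hk.
    apply Rle_trans with (rpow (rpow (U k) (2 / s - 1) * rpow (V k) (1 - (2 / s - 1))) (s / 2)).
    - apply rpow_le; [lra|].
      rewrite (fsum_ext _ _ (fun j =>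
        rpow (rpow (c j) (2 * s - 2) * (b j k * b j k)) (2 / s - 1) *
        rpow (rpow (c j) (s - 2) * (b j k * b j k)) (1 - (2 / s - 1)))).
      + apply holder; [exact Hth| |]; intros; apply Rmult_le_pos; try apply rpow_ge0; nra.
      + intros j Hj.
        rewrite (rpow_mult (rpow (c j) (2 * s - 2))), (rpow_mult (rpow (c j) (s - 2))), !rpow_rpow
          by (apply rpow_ge0 || nra).
        (* The cancelled power [c_j^0] is 1 only for [c_j > 0]; otherwise row [j] is zero and both
           sides vanish. *)
        destruct (Rle_dec (c j) 0) as [Hcj|Hcj].
        * assert (E0 : b j k * b j k = 0).
          { apply (fsum_eq0 n (fun k => b j k * b j k)); [intros; nra| |assumption].
            rewrite <- (sqrt_sqrt _ (Hc0 j)); fold (c j); pose proof (Hc j).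
            replace (c j) with 0 by lra; lra. }
          rewrite E0, rpow_0l; ring.
        * transitivity (rpow (c j) ((2 * s - 2) * (2 / s - 1) + (s - 2) * (1 - (2 / s - 1))) *
            rpow (b j k * b j k) ((2 / s - 1) + (1 - (2 / s - 1)))).
          -- replace ((2 * s - 2) * (2 / s - 1) + (s - 2) * (1 - (2 / s - 1))) with 0
               by (field; lra).
             replace (2 / s - 1 + (1 - (2 / s - 1))) with 1 by ring.
             rewrite rpow_0r, rpow_1r by (nra || lra); ring.
          -- rewrite !rpow_plus; ring.
    - right; rewrite rpow_mult, !rpow_rpow by apply rpow_ge0.
      f_equal; f_equal; field; lra. }
  eapply Rle_trans; [apply fsum_le; exact HW|].
  (* The second use of Hoelder's inequality runs over the columns, with weight [2 - s] on
     [U_k^(1/2)] and [s - 1] on [V_k]. *)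
  eapply Rle_trans; [apply holder; [lra|intros; apply rpow_ge0|intros; apply HV0]|].
  rewrite HV.
  apply Rle_trans with (rpow (9 / 5 * M * rpow Z (einv p)) (2 - s) * rpow Z (1 - (2 - s))).
  { apply Rmult_le_compat_r; [apply rpow_ge0|apply rpow_le; [lra|exact HU]]. }
  rewrite rpow_mult by (try apply rpow_ge0; lra).
  rewrite rpow_rpow, Rmult_assoc, <- rpow_plus.
  replace (einv p * (2 - s) + (1 - (2 - s))) with ((s - 1) * (2 - s) / s + (s - 1)).
  2:{ replace (einv p) with ((s - 1) / s) by (rewrite <- Hse; field; lra); field; lra. }
  assert (Ht : 0 <= (s - 1) * (2 - s) / s + (s - 1)).
  { apply Rplus_le_le_0_compat; [|lra].
    apply Rle_mult_inv_pos; [apply Rmult_le_pos; lra|lra]. }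
  (* The exponent of [Z] is nonnegative, so [HZ1] can be inserted; the powers of [M] then add up to
     [s]. *)
  apply Rle_trans with (rpow (9 / 5 * M) (2 - s) *
     rpow (9 / 5 * rpow M s) ((s - 1) * (2 - s) / s + (s - 1))).
  { apply Rmult_le_compat_l; [apply rpow_ge0|]; apply rpow_le; assumption. }
  rewrite !rpow_mult, rpow_rpow by (try apply rpow_ge0; lra).
  right; unfold mixed_const.
  replace (rpow (9 / 5) (1 + (s - 1) * (2 - s) / s))
    with (rpow (9 / 5) (2 - s) * rpow (9 / 5) ((s - 1) * (2 - s) / s + (s - 1)))
    by (rewrite <- rpow_plus; f_equal; field; lra).
  replace (rpow M s)
    with (rpow M (2 - s) * rpow M (s * ((s - 1) * (2 - s) / s + (s - 1))))
    by (rewrite <- rpow_plus; f_equal; field; lra).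
  ring.
Qed.

Definition hl_exp (p q : ext) : R := / (1 - einv p - einv q).

(** Multiplying column [k] by [y_k], with [y] in the unit ball of l_q, gives a form on l_p and c_0
    still bounded by [M], so [mixed_bound_c0] applies. For [y_k = v_k^(lambda/q) Y^(-1/q)] its left
    side becomes [Y^(1 - s/q)], and the power [lambda / s] recovers [Y]. *)
Lemma mixed_bound p q n a M :
  admissible p -> admissible q -> einv p + einv q < 1 -> 0 <= M ->
  (forall x y, fball p n x -> fball q n y -> Rabs (bform n a x y) <= M) ->
  fsum n (fun k => rpow (fsum n (fun j => a j k * a j k)) (hl_exp p q / 2))
  <= rpow (mixed_const (conj_exp p)) (hl_exp p q / conj_exp p) * rpow M (hl_exp p q).
Proof.
  intros Hp Hq Hpq HM H; pose proof (conj_exp_bounds p Hp) as Hs.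
  pose proof (einv_bounds p Hp) as Hep; pose proof (einv_bounds q Hq) as Heq.
  assert (Hlam : 0 < hl_exp p q) by (apply Rinv_0_lt_compat; lra).
  pose proof (fun b => mixed_bound_c0 p n b M Hp HM) as H0.
  (* This is [1/s = 1/lambda + 1/q] multiplied by [s * lambda]. *)
  assert (Hrel : conj_exp p * (hl_exp p q * einv q) + conj_exp p = hl_exp p q).
  { unfold conj_exp, hl_exp; field; lra. }
  set (s := conj_exp p) in *; set (lam := hl_exp p q) in *.
  set (v := fun k => sqrt (fsum n (fun j => a j k * a j k))).
  assert (HW0 : forall k, 0 <= fsum n (fun j => a j k * a j k))
    by (intros; apply fsum_sqr_ge0).
  assert (Hv : forall k, 0 <= v k) by (intros; apply sqrt_pos).
  assert (Hvv : forall k t, rpow (fsum n (fun j => a j k * a j k)) (t / 2) = rpow (v k) t).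
  { intros k t; unfold v; rewrite <- rpow_sqrt, rpow_rpow by apply HW0; f_equal; field. }
  rewrite (fsum_ext _ _ _ (fun k _ => Hvv k lam)).
  set (Y := fsum n (fun k => rpow (v k) lam)).
  destruct (Rle_dec Y 0) as [HY|HY].
  { apply Rle_trans with 0; [exact HY|apply Rmult_le_pos; apply rpow_ge0]. }
  set (y := fun k => rpow (v k) (lam * einv q) * rpow Y (- einv q)).
  assert (Hy : fball q n y) by (apply fball_normalized; auto; fold Y; lra).
  assert (Hy0 : forall k, 0 <= y k) by (intros; apply Rmult_le_pos; apply rpow_ge0).
  specialize (H0 (fun j k => a j k * y k)).
  assert (H1 : forall x u, fball p n x -> fball Inf n u ->
    Rabs (bform n (fun j k => a j k * y k) x u) <= M).
  { intros x u Hx Hu.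
    replace (bform n (fun j k => a j k * y k) x u) with (bform n a x (fun k => y k * u k)).
    - apply H; [exact Hx|]; apply (fball_le q n y); auto; intros k Hk.
      rewrite Rabs_mult; pose proof (Rabs_pos (y k)); pose proof (Hu k Hk); nra.
    - apply fsum_ext; intros j _; apply fsum_ext; intros; ring. }
  specialize (H0 H1).
  rewrite (fsum_ext _ _ (fun k => rpow Y (- (s * einv q)) * rpow (v k) lam)) in H0.
  - rewrite fsum_scal in H0; fold Y in H0.
    rewrite <- (rpow_1r Y) in H0 at 2 by lra; rewrite <- rpow_plus in H0.
    apply (rpow_le _ _ (lam / s)) in H0; [|apply Rlt_le, Rdiv_lt_0_compat; lra].
    rewrite rpow_rpow, rpow_mult, (rpow_rpow M) in H0 by apply rpow_ge0.
    replace ((- (s * einv q) + 1) * (lam / s)) with 1 in H0.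
    + replace (s * (lam / s)) with lam in H0 by (field; lra).
      rewrite rpow_1r in H0 by lra; exact H0.
    + apply (Rmult_eq_reg_r s); [|lra].
      replace ((- (s * einv q) + 1) * (lam / s) * s) with (lam - s * (lam * einv q)) by (field; lra).
      lra.
  - intros k _.
    replace (fsum n (fun j => a j k * y k * (a j k * y k)))
      with (rpow (y k) 2 * fsum n (fun j => a j k * a j k)).
    + rewrite rpow_mult, rpow_rpow, Hvv by (apply rpow_ge0 || apply HW0).
      replace (2 * (s / 2)) with s by field.
      unfold y; rewrite rpow_mult, !rpow_rpow by apply rpow_ge0.
      replace (lam * einv q * s) with (s * (lam * einv q)) by ring.
      rewrite <- Hrel at 2; rewrite rpow_plus.
      replace (- einv q * s) with (- (s * einv q)) by ring; ring.
    + rewrite rpow_2 by apply Hy0; rewrite <- fsum_scal; apply fsum_ext; intros; ring.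
Qed.

(** * Series *)

Lemma infinite_sum_fsum f n :
  (forall i, (n <= i)%nat -> f i = 0) -> infinite_sum f (fsum n f).
Proof.
  intros H eps Heps; exists n; intros m Hm.
  rewrite sum_f_R0_fsum, (fsum_trunc n (S m)) by (lia || exact H).
  rewrite Rdist_eq; exact Heps.
Qed.

Lemma fsum_le_infinite_sum f l n :
  (forall i, 0 <= f i) -> infinite_sum f l -> fsum n f <= l.
Proof.
  intros Hf Hl; apply Rle_trans with (fsum (S n) f).
  - apply fsum_incl; [lia|exact Hf].
  - rewrite <- sum_f_R0_fsum; now apply sum_incr.
Qed.

(** The sum is returned in a [sig] type so that [mixed_series] can define the sequence of inner sums
    by projection. *)
Lemma bounded_infinite_sum f B :
  (forall i, 0 <= f i) -> (forall n, fsum n f <= B) -> {l | infinite_sum f l /\ l <= B}.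
Proof.
  intros Hf HB.
  destruct (growing_cv (fun n => sum_f_R0 f n)) as [l Hl].
  - intros n; simpl; pose proof (Hf (S n)); lra.
  - exists B; intros v [n ->]; rewrite sum_f_R0_fsum; apply HB.
  - exists l; split; [exact Hl|].
    destruct (Rle_dec l B) as [H|H]; [exact H|].
    destruct (Hl (l - B) ltac:(lra)) as [N HN].
    specialize (HN N (Nat.le_refl N)); unfold Rdist in HN.
    rewrite sum_f_R0_fsum in HN; pose proof (HB (S N)).
    rewrite Rabs_left1 in HN; lra.
Qed.

(** The upper bound [l] settles [l <= 0], where every term is 0; for [l > 0] the sequence is
    eventually positive and [Rpower] is continuous at [l]. *)
Lemma rpow_cv u l t :
  (forall n, u n <= l) -> Un_cv u l -> Un_cv (fun n => rpow (u n) t) (rpow l t).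
Proof.
  intros Hu Hl; destruct (Rle_dec l 0) as [H|H].
  - rewrite (rpow_nonpos l) by assumption; intros eps Heps; exists 0%nat; intros n _.
    rewrite rpow_nonpos, Rdist_eq by (eapply Rle_trans; [apply Hu|exact H]); exact Heps.
  - assert (Hc : continuity_pt (fun x => Rpower x t) l).
    { apply derivable_continuous_pt; exists (t * Rpower l (t - 1)).
      apply derivable_pt_lim_power; lra. }
    pose proof (continuity_seq _ _ _ Hc Hl) as HR.
    intros eps Heps; destruct (HR eps Heps) as [N1 H1].
    destruct (Hl l ltac:(lra)) as [N2 H2].
    exists (N1 + N2)%nat; intros n Hn.
    specialize (H1 n ltac:(lia)); specialize (H2 n ltac:(lia)).
    unfold Rdist in H2; apply Rabs_def2 in H2.
    rewrite !rpow_Rpower by lra; exact H1.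
Qed.

Lemma fsum_cv m (u : nat -> nat -> R) (l : nat -> R) :
  (forall k, Un_cv (fun n => u k n) (l k)) -> Un_cv (fun n => fsum m (fun k => u k n)) (fsum m l).
Proof.
  intros H; induction m as [|m IH]; simpl.
  - intros eps Heps; exists 0%nat; intros; rewrite Rdist_eq; exact Heps.
  - apply (CV_plus _ _ _ _ IH (H m)).
Qed.

(** Passage from square truncations to the double series: inner partial sums are bounded by
    [B^(1/t)], hence converge, and for a fixed number of columns the bound survives the limit in the
    rows. *)
Lemma mixed_series (g : nat -> nat -> R) t B :
  0 < t -> (forall j k, 0 <= g j k) ->
  (forall n, fsum n (fun k => rpow (fsum n (fun j => g j k)) t) <= B) ->
  exists inner l, (forall k, infinite_sum (fun j => g j k) (inner k)) /\
    infinite_sum (fun k => rpow (inner k) t) l /\ l <= B.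
Proof.
  intros Ht Hg HB.
  (* A rectangle [m] by [n] lies inside the square of side [m + n]. *)
  assert (HB2 : forall m n, fsum m (fun k => rpow (fsum n (fun j => g j k)) t) <= B).
  { intros m n; eapply Rle_trans; [|apply (HB (m + n)%nat)].
    eapply Rle_trans; [apply (fsum_incl m (m + n)); [lia|intros; apply rpow_ge0]|].
    apply fsum_le; intros k _; apply rpow_le; [lra|apply fsum_incl; [lia|auto]]. }
  assert (Hk : forall k n, fsum n (fun j => g j k) <= rpow B (/ t)).
  { intros k n.
    assert (H1 : rpow (fsum n (fun j => g j k)) t <= B).
    { eapply Rle_trans; [|apply (HB2 (S k) n)].
      apply (fsum_term (S k) (fun k => rpow (fsum n (fun j => g j k)) t)); [lia|].
      intros; apply rpow_ge0. }
    apply (rpow_le _ _ (/ t)) in H1; [|apply Rlt_le; now apply Rinv_0_lt_compat].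
    rewrite rpow_rpow, Rinv_r, rpow_1r in H1 by (lra || (apply fsum_ge0; auto)); exact H1. }
  pose (inner := fun k => proj1_sig (bounded_infinite_sum _ _ (fun j => Hg j k) (Hk k))).
  assert (Hin : forall k, infinite_sum (fun j => g j k) (inner k)).
  { intros k; unfold inner; exact (proj1 (proj2_sig (bounded_infinite_sum _ _ _ (Hk k)))). }
  destruct (bounded_infinite_sum (fun k => rpow (inner k) t) B) as [l [Hl HlB]].
  - intros; apply rpow_ge0.
  - intros m.
    apply (@Rle_cv_lim (fun n => fsum m (fun k => rpow (sum_f_R0 (fun j => g j k) n) t))
                       (fun _ => B)).
    + intros n; rewrite (fsum_ext _ _ (fun k => rpow (fsum (S n) (fun j => g j k)) t))
        by (intros; now rewrite sum_f_R0_fsum); apply HB2.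
    + apply (fsum_cv m (fun k n => rpow (sum_f_R0 (fun j => g j k) n) t)); intros k.
      apply rpow_cv; [|apply Hin].
      intros n; apply sum_incr; [apply Hin|auto].
    + intros eps Heps; exists 0%nat; intros; rewrite Rdist_eq; exact Heps.
  - exists inner, l; auto.
Qed.

(** The larger of [x] and [y] is at least half their sum. This recombines real and imaginary
    parts. *)
Lemma rpow_plus_le x y t :
  0 <= t -> 0 <= x -> 0 <= y -> rpow (x + y) t <= rpow 2 t * (rpow x t + rpow y t).
Proof.
  intros Ht Hx Hy; pose proof (rpow_ge0 x t); pose proof (rpow_ge0 y t).
  pose proof (rpow_ge0 2 t).
  destruct (Rle_dec x y) as [H'|H'].
  - apply Rle_trans with (rpow (2 * y) t); [apply rpow_le; lra|].
    rewrite rpow_mult by lra; nra.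
  - apply Rle_trans with (rpow (2 * x) t); [apply rpow_le; lra|].
    rewrite rpow_mult by lra; nra.
Qed.

(** * Matrices of small norm *)

(** Sizes are powers of 2 to suit Sylvester's matrices; [2 ^ m] exceeds [m], which is unbounded. *)
Lemma pow2_rpow_unbounded d C : 0 < d -> exists m, C < rpow (INR (2 ^ m)) d.
Proof.
  intros Hd; destruct (INR_unbounded (rpow (Rabs C + 1) (/ d))) as [m Hm]; exists m.
  pose proof (Rle_abs C); pose proof (Rabs_pos C).
  apply Rlt_le_trans with (Rabs C + 1); [lra|].
  replace (Rabs C + 1) with (rpow (rpow (Rabs C + 1) (/ d)) d)
    by (rewrite rpow_rpow, Rinv_l by lra; apply rpow_1r; lra).
  apply rpow_le; [lra|].
  apply Rle_trans with (INR m); [lra|]; apply le_INR.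
  apply Nat.lt_le_incl, Nat.pow_gt_lin_r; lia.
Qed.

(** The choice is [X_j = n |x_j|^p] for finite [p] and [X_j = 1] for [p = Inf], so [X] has mean at
    most 1. This lets both cases be treated at once. *)
Lemma fball_profile p n x :
  admissible p -> (0 < n)%nat -> fball p n x ->
  exists X, (forall j, 0 <= X j) /\ fsum n X <= INR n /\
    forall j, (j < n)%nat -> Rabs (x j) <= rpow (INR n) (- einv p) * rpow (X j) (einv p).
Proof.
  intros Hp Hn Hx; pose proof (lt_0_INR n Hn) as HI; destruct p as [r|]; simpl in *.
  - exists (fun j => INR n * rpow (Rabs (x j)) r); split; [|split].
    + intros j; apply Rmult_le_pos; [lra|apply rpow_ge0].
    + rewrite fsum_scal; nra.
    + intros j _; rewrite rpow_mult, rpow_rpow by (apply rpow_ge0 || lra).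
      rewrite <- Rmult_assoc, (Rmult_comm (rpow (INR n) (- / r))), rpow_opp by assumption.
      rewrite Rinv_r, rpow_1r by (apply Rabs_pos || lra); lra.
  - exists (fun _ => 1); split; [|split].
    + intros; lra.
    + rewrite fsum_const; lra.
    + intros j Hj; rewrite Ropp_0, rpow_0r, rpow_1l by assumption.
      rewrite Rmult_1_r; auto.
Qed.

Lemma rpow_le_succ x t : 0 <= t <= 1 -> 0 <= x -> rpow x t <= x + 1.
Proof.
  intros Ht Hx; pose proof (weighted_amgm x 1 t Ht Hx ltac:(lra)) as H.
  rewrite rpow_1l in H; nra.
Qed.

(** * The identity matrix *)

Definition id_mat (j k : nat) : R := if Nat.eqb j k then 1 else 0.

Lemma bform_id_mat n x y : bform n id_mat x y = fsum n (fun j => x j * y j).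
Proof.
  apply fsum_ext; intros j Hj; rewrite (fsum_single n j); [|assumption|].
  - unfold id_mat; rewrite Nat.eqb_refl; ring.
  - intros i _ Hi; unfold id_mat; destruct (Nat.eqb_spec j i); [lia|ring].
Qed.

(** For the profiles of [x] and [y], [X_j^(1/p) Y_j^(1/q) <= X_j + Y_j + 1] because the exponents
    add up to less than 1. Each of the three terms sums to at most [n], whence the factor 3. *)
Lemma id_mat_bound p q n x y :
  admissible p -> admissible q -> einv p + einv q < 1 -> (0 < n)%nat ->
  fball p n x -> fball q n y ->
  Rabs (bform n id_mat x y) <= 3 * rpow (INR n) (1 - einv p - einv q).
Proof.
  intros Hp Hq Hpq Hn Hx Hy.
  pose proof (einv_bounds p Hp); pose proof (einv_bounds q Hq); pose proof (lt_0_INR n Hn).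
  destruct (fball_profile p n x Hp Hn Hx) as [X [HX0 [HX1 HX]]].
  destruct (fball_profile q n y Hq Hn Hy) as [Y [HY0 [HY1 HY]]].
  rewrite bform_id_mat; eapply Rle_trans; [apply fsum_abs|].
  apply Rle_trans with (fsum n (fun j => rpow (INR n) (- einv p + - einv q) * (X j + Y j + 1))).
  - apply fsum_le; intros j Hj; rewrite Rabs_mult, rpow_plus.
    apply Rle_trans with ((rpow (INR n) (- einv p) * rpow (X j) (einv p)) *
                          (rpow (INR n) (- einv q) * rpow (Y j) (einv q))).
    + apply Rmult_le_compat; auto; apply Rabs_pos.
    + replace (rpow (INR n) (- einv p) * rpow (X j) (einv p) *
               (rpow (INR n) (- einv q) * rpow (Y j) (einv q)))
        with (rpow (INR n) (- einv p) * rpow (INR n) (- einv q) *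
               (rpow (X j) (einv p) * rpow (Y j) (einv q))) by ring.
      apply Rmult_le_compat_l; [apply Rmult_le_pos; apply rpow_ge0|].
      pose proof (Rmax_l (X j) (Y j)); pose proof (Rmax_r (X j) (Y j)).
      pose proof (HX0 j); pose proof (HY0 j).
      (* Both bases are enlarged to their maximum so that the exponents can be added. *)
      apply Rle_trans with (rpow (Rmax (X j) (Y j)) (einv p) * rpow (Rmax (X j) (Y j)) (einv q)).
      * apply Rmult_le_compat; try apply rpow_ge0; apply rpow_le; lra.
      * rewrite <- rpow_plus; eapply Rle_trans; [apply rpow_le_succ; lra|].
        unfold Rmax; destruct Rle_dec; lra.
  - rewrite fsum_scal, !fsum_plus, fsum_const.
    replace (1 - einv p - einv q) with ((- einv p + - einv q) + 1) by ring.
    rewrite (rpow_plus _ _ 1), rpow_1r by lra.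
    pose proof (rpow_ge0 (INR n) (- einv p + - einv q)); nra.
Qed.

(** Sylvester's matrices: [H_(m+1)] has the blocks [H_m, H_m; H_m, - H_m]. *)
Fixpoint hadamard (m : nat) (j k : nat) : R :=
  match m with
  | O => 1
  | S m =>
      let N := (2 ^ m)%nat in
      if Nat.ltb j N then hadamard m j (if Nat.ltb k N then k else k - N)
      else if Nat.ltb k N then hadamard m (j - N) k else - hadamard m (j - N) (k - N)
  end.

Lemma hadamard_abs m j k : Rabs (hadamard m j k) = 1.
Proof.
  revert j k; induction m as [|m IH]; intros j k; simpl; [apply Rabs_R1|].
  destruct (Nat.ltb j _), (Nat.ltb k _); rewrite ?Rabs_Ropp; apply IH.
Qed.

Lemma bform_hadamard_S m x y :
  let N := (2 ^ m)%nat in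
  bform (2 ^ S m) (hadamard (S m)) x y =
  bform N (hadamard m) (fun j => x j + x (N + j)%nat) y +
  bform N (hadamard m) (fun j => x j - x (N + j)%nat) (fun k => y (N + k)%nat).
Proof.
  intros N; replace (2 ^ S m)%nat with (N + N)%nat by (unfold N; simpl; lia).
  unfold bform; rewrite fsum_split, <- !fsum_plus; apply fsum_ext; intros j Hj.
  rewrite !fsum_split, <- !fsum_plus; apply fsum_ext; intros k Hk.
  assert (E1 : Nat.ltb j N = true) by now apply Nat.ltb_lt.
  assert (E2 : Nat.ltb k N = true) by now apply Nat.ltb_lt.
  assert (E3 : Nat.ltb (N + j) N = false) by (apply Nat.ltb_ge; lia).
  assert (E4 : Nat.ltb (N + k) N = false) by (apply Nat.ltb_ge; lia).
  cbn [hadamard]; fold N; rewrite E1, E2, E3, E4.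
  replace (N + j - N)%nat with j by lia; replace (N + k - N)%nat with k by lia; ring.
Qed.

(** Induction on the block structure: the parallelogram identity handles the two halves of [x], and
    a Cauchy-Schwarz argument combines the two smaller forms. *)
Lemma hadamard_l2 m x y :
  (bform (2 ^ m) (hadamard m) x y) ^ 2 <=
  INR (2 ^ m) * (fsum (2 ^ m) (fun j => x j * x j) * fsum (2 ^ m) (fun k => y k * y k)).
Proof.
  revert x y; induction m as [|m IH]; intros x y.
  { unfold bform; simpl; right; ring. }
  rewrite bform_hadamard_S; set (N := (2 ^ m)%nat) in *.
  replace (2 ^ S m)%nat with (N + N)%nat by (unfold N; simpl; lia).
  rewrite !fsum_split, plus_INR.
  pose proof (IH (fun j => x j + x (N + j)%nat) y) as H1.
  pose proof (IH (fun j => x j - x (N + j)%nat) (fun k => y (N + k)%nat)) as H2.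
  cbv beta in H1, H2.
  set (B1 := bform N (hadamard m) (fun j => x j + x (N + j)%nat) y) in *.
  set (B2 := bform N (hadamard m) (fun j => x j - x (N + j)%nat) (fun k => y (N + k)%nat)) in *.
  assert (HP : fsum N (fun j => (x j + x (N + j)%nat) * (x j + x (N + j)%nat)) +
               fsum N (fun j => (x j - x (N + j)%nat) * (x j - x (N + j)%nat)) =
               2 * (fsum N (fun j => x j * x j) + fsum N (fun j => x (N + j)%nat * x (N + j)%nat))).
  { rewrite <- !fsum_plus, <- fsum_scal; apply fsum_ext; intros; ring. }
  set (P := fsum N (fun j => (x j + x (N + j)%nat) * (x j + x (N + j)%nat))) in *.
  set (Q := fsum N (fun j => (x j - x (N + j)%nat) * (x j - x (N + j)%nat))) in *.
  set (Y1 := fsum N (fun k => y k * y k)) in *.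
  set (Y2 := fsum N (fun k => y (N + k)%nat * y (N + k)%nat)) in *.
  assert (0 <= P) by apply (fsum_sqr_ge0 N (fun j => x j + x (N + j)%nat)).
  assert (0 <= Q) by apply (fsum_sqr_ge0 N (fun j => x j - x (N + j)%nat)).
  assert (0 <= Y1) by apply fsum_sqr_ge0.
  assert (0 <= Y2) by apply (fsum_sqr_ge0 N (fun k => y (N + k)%nat)).
  pose proof (pos_INR N) as HN.
  replace ((INR N + INR N) * ((fsum N (fun j => x j * x j) +
             fsum N (fun i => x (N + i)%nat * x (N + i)%nat)) * (Y1 + Y2)))
    with (INR N * ((P + Q) * (Y1 + Y2))) by (rewrite HP; ring).
  clearbody P Q Y1 Y2 B1 B2; clear HP IH.
  (* The cross term: [B1^2 B2^2 <= N^2 (P Y1) (Q Y2)] by induction, followed by AM-GM for [P Y2] and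
     [Q Y1]. *)
  assert (HC : 2 * (B1 * B2) <= INR N * (P * Y2 + Q * Y1)).
  { apply Rsqr_incr_0_var; [|apply Rmult_le_pos; [lra|]; apply Rplus_le_le_0_compat; nra].
    apply Rle_trans with (4 * ((INR N * (P * Y1)) * (INR N * (Q * Y2)))).
    - unfold Rsqr; replace (2 * (B1 * B2) * (2 * (B1 * B2))) with (4 * (B1 ^ 2 * B2 ^ 2)) by ring.
      apply Rmult_le_compat_l; [lra|]; apply Rmult_le_compat; try apply pow2_ge_0; assumption.
    - unfold Rsqr.
      pose proof (pow2_ge_0 (INR N * (P * Y2 - Q * Y1))); nra. }
  nra.
Qed.

(** Since [2/p <= 1], each [X_j^(2/p)] of the profile is at most [X_j + 1], and these sum to at most
    [2 n]. *)
Lemma fball_l2 p n x :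
  admissible p -> (0 < n)%nat -> fball p n x ->
  fsum n (fun j => x j * x j) <= 2 * rpow (INR n) (1 - 2 * einv p).
Proof.
  intros Hp Hn Hx; pose proof (einv_bounds p Hp); pose proof (lt_0_INR n Hn).
  destruct (fball_profile p n x Hp Hn Hx) as [X [HX0 [HX1 HX]]].
  apply Rle_trans with (fsum n (fun j => rpow (INR n) (- (2 * einv p)) * (X j + 1))).
  - apply fsum_le; intros j Hj; rewrite <- rpow_abs_2.
    apply Rle_trans with (rpow (rpow (INR n) (- einv p) * rpow (X j) (einv p)) 2).
    + apply rpow_le; [lra|auto].
    + rewrite rpow_mult, !rpow_rpow by apply rpow_ge0.
      replace (- einv p * 2) with (- (2 * einv p)) by ring.
      apply Rmult_le_compat_l; [apply rpow_ge0|apply rpow_le_succ; [lra|auto]].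
  - rewrite fsum_scal, fsum_plus, fsum_const.
    replace (1 - 2 * einv p) with (- (2 * einv p) + 1) by ring.
    rewrite rpow_plus, rpow_1r by lra.
    pose proof (rpow_ge0 (INR n) (- (2 * einv p))); nra.
Qed.

(** Inserting the l_2 norms of [x] and [y] into [hadamard_l2] gives
    [n * 2 n^(1 - 2/p) * 2 n^(1 - 2/q)], the square of the right side. *)
Lemma hadamard_bound p q m x y :
  admissible p -> admissible q ->
  fball p (2 ^ m) x -> fball q (2 ^ m) y ->
  Rabs (bform (2 ^ m) (hadamard m) x y)
  <= 2 * rpow (INR (2 ^ m)) (/ 2 + (1 - einv p - einv q)).
Proof.
  intros Hp Hq Hx Hy.
  assert (Hn : (0 < 2 ^ m)%nat) by (apply Nat.neq_0_lt_0, Nat.pow_nonzero; lia).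
  pose proof (hadamard_l2 m x y) as H.
  pose proof (fball_l2 p _ x Hp Hn Hx) as H1; pose proof (fball_l2 q _ y Hq Hn Hy) as H2.
  set (n := (2 ^ m)%nat) in *; pose proof (lt_0_INR n Hn).
  set (t := / 2 + (1 - einv p - einv q)); pose proof (rpow_ge0 (INR n) t).
  apply Rsqr_incr_0_var; [|lra]; rewrite <- Rsqr_abs; unfold Rsqr.
  replace (2 * rpow (INR n) t * (2 * rpow (INR n) t))
    with (INR n * (2 * rpow (INR n) (1 - 2 * einv p) * (2 * rpow (INR n) (1 - 2 * einv q)))).
  - replace (bform n (hadamard m) x y * bform n (hadamard m) x y)
      with (bform n (hadamard m) x y ^ 2) by ring.
    eapply Rle_trans; [exact H|]; apply Rmult_le_compat_l; [lra|].
    apply Rmult_le_compat; auto; apply fsum_sqr_ge0.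
  - rewrite <- (rpow_1r (INR n)) at 1 by lra.
    transitivity (4 * rpow (INR n) (1 + (1 - 2 * einv p) + (1 - 2 * einv q))).
    + rewrite !rpow_plus; ring.
    + replace (1 + (1 - 2 * einv p) + (1 - 2 * einv q)) with (t + t) by (unfold t; field).
      rewrite rpow_plus; ring.
Qed.

(** * Real and complex forms *)

(** Both scalar fields are described by a real and an imaginary part; for the reals the
    imaginary part is [0]. *)
Record coordinates (K : Scal) (re im : car K -> R) (inj : R -> car K) : Prop := {
  coord_ext : forall z w, re z = re w -> im z = im w -> z = w;
  re_add : forall z w, re (sadd K z w) = re z + re w;
  im_add : forall z w, im (sadd K z w) = im z + im w;
  re_mul : forall z w, re (smul K z w) = re z * re w - im z * im w;
  im_mul : forall z w, im (smul K z w) = re z * im w + im z * re w;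
  re_inj : forall a, re (inj a) = a;
  im_inj : forall a, im (inj a) = 0;
  zero_inj : szero K = inj 0;
  one_inj : sone K = inj 1;
  sabs_coord : forall z, sabs K z = sqrt (re z * re z + im z * im z) }.

Arguments coord_ext {K re im inj} _ _ _ _ _.
Arguments re_add {K re im inj} _ _ _.
Arguments im_add {K re im inj} _ _ _.
Arguments re_mul {K re im inj} _ _ _.
Arguments im_mul {K re im inj} _ _ _.
Arguments re_inj {K re im inj} _ _.
Arguments im_inj {K re im inj} _ _.
Arguments zero_inj {K re im inj} _.
Arguments one_inj {K re im inj} _.
Arguments sabs_coord {K re im inj} _ _.

Lemma coordinates_RS : coordinates RS (fun z => z) (fun _ => 0) (fun a => a).
Proof.
  constructor; simpl; intros; try ring; try reflexivity; try assumption.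
  rewrite Rmult_0_l, Rplus_0_r; symmetry; apply sqrt_Rsqr_abs.
Qed.

Lemma coordinates_CS : coordinates CS fst snd (fun a => (a, 0)).
Proof.
  constructor; simpl; intros; try reflexivity.
  destruct z, w; simpl in *; now subst.
Qed.

Section Coordinates.

Variables (K : Scal) (re im : car K -> R) (inj : R -> car K).
Hypothesis HK : coordinates K re im inj.

Lemma abs_re_le z : Rabs (re z) <= sabs K z.
Proof.
  rewrite (sabs_coord HK), <- sqrt_Rsqr_abs; apply sqrt_le_1_alt; unfold Rsqr.
  pose proof (Rle_0_sqr (im z)) as H; unfold Rsqr in H; lra.
Qed.

Lemma abs_im_le z : Rabs (im z) <= sabs K z.
Proof.
  rewrite (sabs_coord HK), <- sqrt_Rsqr_abs; apply sqrt_le_1_alt; unfold Rsqr.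
  pose proof (Rle_0_sqr (re z)) as H; unfold Rsqr in H; lra.
Qed.

Lemma sabs_le z : sabs K z <= Rabs (re z) + Rabs (im z).
Proof.
  rewrite (sabs_coord HK).
  pose proof (Rabs_pos (re z)); pose proof (Rabs_pos (im z)).
  rewrite <- (sqrt_square (Rabs (re z) + Rabs (im z))) by lra.
  apply sqrt_le_1_alt.
  rewrite <- (Rabs_pos_eq (re z * re z)), <- (Rabs_pos_eq (im z * im z)), !Rabs_mult by nra.
  nra.
Qed.

Lemma sabs_ge0 z : 0 <= sabs K z.
Proof. rewrite (sabs_coord HK); apply sqrt_pos. Qed.

Lemma sabs_sqr z : sabs K z * sabs K z = re z * re z + im z * im z.
Proof. rewrite (sabs_coord HK); apply sqrt_sqrt; nra. Qed.

Lemma sabs_inj a : sabs K (inj a) = Rabs a.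
Proof.
  rewrite (sabs_coord HK), (re_inj HK), (im_inj HK), Rmult_0_l, Rplus_0_r; apply sqrt_Rsqr_abs.
Qed.

Lemma sabs_0 : sabs K (szero K) = 0.
Proof. rewrite (zero_inj HK), sabs_inj; apply Rabs_R0. Qed.

Lemma inX_finite p n (x : seqK K) : (forall j, (n <= j)%nat -> x j = szero K) -> inX p x.
Proof.
  intros H; destruct p as [r|]; simpl.
  - exists (fsum n (fun j => rpow (sabs K (x j)) r)); apply infinite_sum_fsum.
    intros j Hj; rewrite H, sabs_0 by assumption; apply rpow_0l.
  - intros eps Heps; exists n; intros j Hj; rewrite H, sabs_0 by assumption.
    rewrite Rdist_eq; exact Heps.
Qed.

Definition trunc (n : nat) (x : nat -> R) : seqK K :=
  fun j => if Nat.ltb j n then inj (x j) else szero K.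

Lemma trunc_ge n x j : (n <= j)%nat -> trunc n x j = szero K.
Proof. intros H; unfold trunc; destruct (Nat.ltb_spec j n); [lia|reflexivity]. Qed.

Lemma in_ball_trunc p n x : admissible p -> fball p n x -> in_ball p (trunc n x).
Proof.
  intros Hp Hx; split; [apply (inX_finite p n), trunc_ge|].
  destruct p as [r|]; simpl in *.
  - exists (fsum n (fun j => rpow (sabs K (trunc n x j)) r)); split.
    + apply infinite_sum_fsum; intros j Hj; rewrite trunc_ge, sabs_0 by assumption; apply rpow_0l.
    + apply rpow_le_1; [apply Rlt_le, Rinv_0_lt_compat; lra|].
      eapply Rle_trans; [|exact Hx]; right; apply fsum_ext; intros j Hj.
      unfold trunc; destruct (Nat.ltb_spec j n); [now rewrite sabs_inj|lia].
  - intros j; unfold trunc; destruct (Nat.ltb_spec j n).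
    + rewrite sabs_inj; auto.
    + rewrite sabs_0; lra.
Qed.

(** Used with [f] equal to [re] or [im], to bring vectors of the unit ball into the finite real
    setting. *)
Lemma in_ball_fball (f : car K -> R) p n x :
  admissible p -> (forall z, Rabs (f z) <= sabs K z) -> in_ball p x ->
  fball p n (fun j => f (x j)).
Proof.
  intros Hp Hf [_ Hx]; destruct p as [r|]; simpl in *.
  - destruct Hx as [l [Hl Hl1]].
    assert (Hge : fsum n (fun j => rpow (sabs K (x j)) r) <= l).
    { apply fsum_le_infinite_sum; [intros; apply rpow_ge0|exact Hl]. }
    apply Rle_trans with (fsum n (fun j => rpow (sabs K (x j)) r)).
    + apply fsum_le; intros; apply rpow_le; [lra|apply Hf].
    + apply Rle_trans with l; [exact Hge|].
      assert (Hl0 : 0 <= l).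
      { eapply Rle_trans; [|exact Hge]; apply fsum_ge0; intros; apply rpow_ge0. }
      apply (rpow_le_inv _ _ (/ r)); [apply Rinv_0_lt_compat; lra|lra|lra|].
      rewrite rpow_1l; exact Hl1.
  - intros j _; eapply Rle_trans; [apply Hf|apply Hx].
Qed.

(** * Forms given by finite real matrices *)

Fixpoint ksum (n : nat) (f : nat -> car K) : car K :=
  match n with O => szero K | S n => sadd K (ksum n f) (f n) end.

Lemma re_ksum n f : re (ksum n f) = fsum n (fun i => re (f i)).
Proof.
  induction n as [|n IH]; simpl.
  - rewrite (zero_inj HK); apply (re_inj HK).
  - now rewrite (re_add HK), IH.
Qed.

Lemma im_ksum n f : im (ksum n f) = fsum n (fun i => im (f i)).
Proof.
  induction n as [|n IH]; simpl.
  - rewrite (zero_inj HK); apply (im_inj HK).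
  - now rewrite (im_add HK), IH.
Qed.

Definition matform (n : nat) (a : nat -> nat -> R) (x y : seqK K) : car K :=
  ksum n (fun j => ksum n (fun k => smul K (smul K (inj (a j k)) (x j)) (y k))).

Lemma re_matform n a x y :
  re (matform n a x y) =
  bform n a (fun j => re (x j)) (fun k => re (y k)) -
  bform n a (fun j => im (x j)) (fun k => im (y k)).
Proof.
  unfold matform, bform; rewrite re_ksum, <- fsum_minus; apply fsum_ext; intros j _.
  rewrite re_ksum, <- fsum_minus; apply fsum_ext; intros k _.
  rewrite !(re_mul HK), !(im_mul HK), (re_inj HK), (im_inj HK); ring.
Qed.

Lemma im_matform n a x y :
  im (matform n a x y) =
  bform n a (fun j => re (x j)) (fun k => im (y k)) +
  bform n a (fun j => im (x j)) (fun k => re (y k)).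
Proof.
  unfold matform, bform; rewrite im_ksum, <- fsum_plus; apply fsum_ext; intros j _.
  rewrite im_ksum, <- fsum_plus; apply fsum_ext; intros k _.
  rewrite !(im_mul HK), !(re_mul HK), (re_inj HK), (im_inj HK); ring.
Qed.

Lemma matform_lincomb_l n a c x x' y :
  matform n a (lincomb c x x') y = sadd K (smul K c (matform n a x y)) (matform n a x' y).
Proof.
  apply (coord_ext HK); rewrite ?(re_add HK), ?(im_add HK), ?(re_mul HK), ?(im_mul HK);
    unfold matform; rewrite !re_ksum, !im_ksum, <- ?fsum_scal, <- ?fsum_minus, <- ?fsum_plus,
    <- ?fsum_minus, <- ?fsum_plus; apply fsum_ext; intros j _;
    rewrite !re_ksum, !im_ksum, <- ?fsum_scal, <- ?fsum_minus, <- ?fsum_plus,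
    <- ?fsum_minus, <- ?fsum_plus; apply fsum_ext; intros k _; unfold lincomb;
    repeat rewrite ?(re_add HK), ?(im_add HK), ?(re_mul HK), ?(im_mul HK); ring.
Qed.

Lemma matform_lincomb_r n a c x y y' :
  matform n a x (lincomb c y y') = sadd K (smul K c (matform n a x y)) (matform n a x y').
Proof.
  apply (coord_ext HK); rewrite ?(re_add HK), ?(im_add HK), ?(re_mul HK), ?(im_mul HK);
    unfold matform; rewrite !re_ksum, !im_ksum, <- ?fsum_scal, <- ?fsum_minus, <- ?fsum_plus,
    <- ?fsum_minus, <- ?fsum_plus; apply fsum_ext; intros j _;
    rewrite !re_ksum, !im_ksum, <- ?fsum_scal, <- ?fsum_minus, <- ?fsum_plus,
    <- ?fsum_minus, <- ?fsum_plus; apply fsum_ext; intros k _; unfold lincomb;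
    repeat rewrite ?(re_add HK), ?(im_add HK), ?(re_mul HK), ?(im_mul HK); ring.
Qed.

Lemma re_e j i : re (e (K := K) j i) = if Nat.eqb i j then 1 else 0.
Proof.
  unfold e; destruct (Nat.eqb i j); [rewrite (one_inj HK)|rewrite (zero_inj HK)];
    apply (re_inj HK).
Qed.

Lemma im_e j i : im (e (K := K) j i) = 0.
Proof.
  unfold e; destruct (Nat.eqb i j); [rewrite (one_inj HK)|rewrite (zero_inj HK)];
    apply (im_inj HK).
Qed.

Lemma matform_e n a j k :
  matform n a (e j) (e k) = inj (if andb (Nat.ltb j n) (Nat.ltb k n) then a j k else 0).
Proof.
  apply (coord_ext HK); rewrite ?(re_inj HK), ?(im_inj HK).
  - rewrite re_matform; unfold bform.
    rewrite (fsum_0 n (fun j0 => fsum n (fun k0 => a j0 k0 * im (e j j0) * im (e k k0))))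
      by (intros; apply fsum_0; intros; rewrite im_e; ring).
    rewrite Rminus_0_r.
    destruct (Nat.ltb_spec j n) as [Hj|Hj]; simpl.
    + rewrite (fsum_single n j); [|assumption|].
      * destruct (Nat.ltb_spec k n) as [Hk|Hk].
        -- rewrite (fsum_single n k); [|assumption|].
           ++ rewrite !re_e, !Nat.eqb_refl; ring.
           ++ intros i _ Hi; rewrite !re_e; apply Nat.eqb_neq in Hi; rewrite Hi; ring.
        -- apply fsum_0; intros i Hi; rewrite !re_e.
           destruct (Nat.eqb_spec i k); [lia|ring].
      * intros i _ Hi; apply fsum_0; intros; rewrite !re_e.
        apply Nat.eqb_neq in Hi; rewrite Hi; ring.
    + apply fsum_0; intros i Hi; apply fsum_0; intros; rewrite !re_e.
      destruct (Nat.eqb_spec i j); [lia|ring].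
  - rewrite im_matform; unfold bform.
    rewrite !fsum_0; [ring| |]; intros; apply fsum_0; intros; rewrite im_e; ring.
Qed.

(** The real and the imaginary part of a value each combine two values of the real form at unit
    vectors, whence the factor 4. *)
Lemma matform_opnorm p q n a M :
  admissible p -> admissible q ->
  (forall x y, fball p n x -> fball q n y -> Rabs (bform n a x y) <= M) ->
  cont_bilinear p q (matform n a) /\
  exists N, is_opnorm p q (matform n a) N /\ 0 <= N <= 4 * M.
Proof.
  intros Hp Hq H.
  assert (HM : forall x y, in_ball p x -> in_ball q y -> sabs K (matform n a x y) <= 4 * M).
  { intros x y Hx Hy.
    pose proof (in_ball_fball re p n x Hp abs_re_le Hx) as Hxr.
    pose proof (in_ball_fball im p n x Hp abs_im_le Hx) as Hxi.
    pose proof (in_ball_fball re q n y Hq abs_re_le Hy) as Hyr.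
    pose proof (in_ball_fball im q n y Hq abs_im_le Hy) as Hyi.
    eapply Rle_trans; [apply sabs_le|]; rewrite re_matform, im_matform.
    pose proof (H _ _ Hxr Hyr) as H1; pose proof (H _ _ Hxi Hyi) as H2.
    pose proof (H _ _ Hxr Hyi) as H3; pose proof (H _ _ Hxi Hyr) as H4.
    revert H1 H2 H3 H4; unfold Rabs; repeat destruct Rcase_abs; lra. }
  split; [split; [|split]|].
  - intros; apply matform_lincomb_l.
  - intros; apply matform_lincomb_r.
  - exists (4 * M); exact HM.
  (* The zero vector makes the set of values nonempty, as completeness requires. *)
  - assert (Hz : forall p', admissible p' -> in_ball p' (trunc 0 (fun _ => 0))).
    { intros p' Hp'; apply in_ball_trunc; [assumption|].
      destruct p'; simpl; [lra|intros; lia]. }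
    destruct (completeness (fun v => exists x y, in_ball p x /\ in_ball q y /\
                              v = sabs K (matform n a x y))) as [N HN].
    + exists (4 * M); intros v [x [y [Hx [Hy ->]]]]; auto.
    + do 3 eexists; exact (conj (Hz p Hp) (conj (Hz q Hq) eq_refl)).
    + exists N; split; [exact HN|split].
      * eapply Rle_trans; [apply sabs_ge0|]; apply (proj1 HN).
        do 2 eexists; exact (conj (Hz p Hp) (conj (Hz q Hq) eq_refl)).
      * apply (proj2 HN); intros v [x [y [Hx [Hy ->]]]]; auto.
Qed.

(** All series involved have finitely many nonzero terms, and uniqueness of sums identifies the
    witnesses inside [mixed_le] with finite sums. *)
Lemma mixed_le_matform n a r s B :
  mixed_le r s (matform n a) B ->
  rpow (fsum n (fun k => rpow (fsum n (fun j => rpow (Rabs (a j k)) r)) (s / r))) (/ s) <= B.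
Proof.
  intros [inner [l [Hi [Hl HB]]]].
  assert (Hin : forall k, inner k =
    if Nat.ltb k n then fsum n (fun j => rpow (Rabs (a j k)) r) else 0).
  { intros k; eapply uniqueness_sum; [apply Hi|].
    replace (if Nat.ltb k n then fsum n (fun j => rpow (Rabs (a j k)) r) else 0)
      with (fsum n (fun j => rpow (sabs K (matform n a (e j) (e k))) r)).
    - apply infinite_sum_fsum; intros j Hj; rewrite matform_e, sabs_inj.
      destruct (Nat.ltb_spec j n); [lia|simpl; rewrite Rabs_R0; apply rpow_0l].
    - destruct (Nat.ltb_spec k n) as [Hk|Hk].
      + apply fsum_ext; intros j Hj; rewrite matform_e, sabs_inj.
        apply Nat.ltb_lt in Hj, Hk; now rewrite Hj, Hk.
      + apply fsum_0; intros j Hj; rewrite matform_e, sabs_inj.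
        apply Nat.ltb_ge in Hk; rewrite Hk, Bool.andb_false_r, Rabs_R0; apply rpow_0l. }
  replace (fsum n (fun k => rpow (fsum n (fun j => rpow (Rabs (a j k)) r)) (s / r))) with l;
    [exact HB|].
  eapply uniqueness_sum; [apply Hl|].
  replace (fsum n (fun k => rpow (fsum n (fun j => rpow (Rabs (a j k)) r)) (s / r)))
    with (fsum n (fun k => rpow (inner k) (s / r))).
  - apply infinite_sum_fsum; intros k Hk; rewrite Hin.
    apply Nat.ltb_ge in Hk; rewrite Hk; apply rpow_0l.
  - apply fsum_ext; intros k Hk; rewrite Hin; apply Nat.ltb_lt in Hk; now rewrite Hk.
Qed.

(** * Arbitrary forms on finitely supported vectors *)

Lemma trunc_S n x : trunc (S n) x = lincomb (inj (x n)) (e n) (trunc n x).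
Proof.
  apply functional_extensionality; intros j; unfold lincomb.
  apply (coord_ext HK); rewrite ?(re_add HK), ?(im_add HK), ?(re_mul HK), ?(im_mul HK),
    ?re_e, ?im_e, ?(re_inj HK), ?(im_inj HK); unfold trunc;
    destruct (Nat.ltb_spec j (S n)), (Nat.ltb_spec j n), (Nat.eqb_spec j n); try lia; subst;
    rewrite ?(zero_inj HK), ?(re_inj HK), ?(im_inj HK); ring.
Qed.

Lemma inX_trunc p n x : inX p (trunc n x).
Proof. apply (inX_finite p n), trunc_ge. Qed.

Lemma inX_e p j : inX p (e (K := K) j).
Proof.
  apply (inX_finite p (S j)); intros i Hi; unfold e.
  destruct (Nat.eqb_spec i j); [lia|reflexivity].
Qed.

(** Shared by [re] and [im], so that the expansions below serve both. *)
Definition real_linear (f : car K -> R) : Prop :=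
  (forall z w, f (sadd K z w) = f z + f w) /\ (forall a z, f (smul K (inj a) z) = a * f z).

Lemma real_linear_re : real_linear re.
Proof.
  split; [apply (re_add HK)|]; intros a z.
  rewrite (re_mul HK), (re_inj HK), (im_inj HK); ring.
Qed.

Lemma real_linear_im : real_linear im.
Proof.
  split; [apply (im_add HK)|]; intros a z.
  rewrite (im_mul HK), (re_inj HK), (im_inj HK); ring.
Qed.

Lemma trunc_additive_expand f p (F : seqK K -> car K) n x :
  real_linear f ->
  (forall a x x', inX p x -> inX p x' ->
     F (lincomb a x x') = sadd K (smul K a (F x)) (F x')) ->
  f (F (trunc n x)) = fsum n (fun j => x j * f (F (e j))).
Proof.
  intros [Hadd Hmul] HF; induction n as [|n IH]; simpl.
  (* The zero vector satisfies [0 = 1 * 0 + 0], which forces [f (F 0) = 0]. *)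
  - assert (E : trunc 0 x = lincomb (inj 1) (trunc 0 x) (trunc 0 x)).
    { apply functional_extensionality; intros j; unfold lincomb, trunc; simpl.
      apply (coord_ext HK); rewrite ?(re_add HK), ?(im_add HK), ?(re_mul HK), ?(im_mul HK),
        ?(zero_inj HK), ?(re_inj HK), ?(im_inj HK); ring. }
    pose proof (f_equal (fun z => f (F z)) E) as E2; cbv beta in E2.
    rewrite HF, Hadd, Hmul in E2 by apply inX_trunc; lra.
  - rewrite trunc_S, HF, Hadd, Hmul, IH by (apply inX_trunc || apply inX_e); ring.
Qed.

(** Expansion in the left argument and then in the right one. It makes [mixed_bound] available for
    the real and the imaginary part of the matrix of [A]. *)
Lemma bilinear_trunc f p q A n x y :
  real_linear f -> cont_bilinear p q A ->
  f (A (trunc n x) (trunc n y)) = bform n (fun j k => f (A (e j) (e k))) x y.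
Proof.
  intros Hf [Hl [Hr _]].
  rewrite (trunc_additive_expand f p (fun z => A z (trunc n y)))
    by (try exact Hf; intros; apply Hl; auto using inX_trunc).
  rewrite bform_rows; apply fsum_ext; intros j _; f_equal.
  rewrite (trunc_additive_expand f q (fun z => A (e j) z))
    by (try exact Hf; intros; apply Hr; auto using inX_e).
  apply fsum_ext; intros; ring.
Qed.

(** The real and the imaginary part of the matrix of [A] are each bounded by [N] on real unit
    vectors, so [mixed_bound] applies to both. They recombine through [|z|^2 = re^2 + im^2], and
    [mixed_series] passes to the limit. *)
Lemma hl_mixed_inequality p q :
  admissible p -> admissible q -> einv p + einv q < 1 ->
  exists C, 1 <= C /\
    forall A, cont_bilinear p q A ->
      forall N, is_opnorm p q A N -> mixed_le (K := K) 2 (hl_exp p q) A (C * N).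
Proof.
  intros Hp Hq Hpq.
  pose proof (einv_bounds p Hp); pose proof (einv_bounds q Hq).
  assert (Hlam : 0 < hl_exp p q) by (apply Rinv_0_lt_compat; lra).
  pose proof (fun n a M => mixed_bound p q n a M Hp Hq Hpq) as HU.
  set (lam := hl_exp p q) in *.
  set (C0 := rpow (mixed_const (conj_exp p)) (lam / conj_exp p)) in *.
  set (C1 := rpow 2 (lam / 2) * (C0 + C0)).
  assert (HC0 : 0 <= C0) by apply rpow_ge0.
  assert (HC1 : 0 <= C1) by (apply Rmult_le_pos; [apply rpow_ge0|lra]).
  (* The summand 1 guarantees [1 <= C]; it only enlarges the bound, as [N >= 0]. *)
  exists (1 + rpow C1 (/ lam)); split; [pose proof (rpow_ge0 C1 (/ lam)); lra|].
  intros A HA N HN.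
  assert (HAN : forall x y, in_ball p x -> in_ball q y -> sabs K (A x y) <= N).
  { intros x y Hx Hy; apply (proj1 HN); now exists x, y. }
  assert (HN0 : 0 <= N).
  { eapply Rle_trans; [apply (sabs_ge0 (A (trunc 0 (fun _ => 0)) (trunc 0 (fun _ => 0))))|].
    apply HAN; apply in_ball_trunc; auto.
    - destruct p; simpl; [lra|intros; lia].
    - destruct q; simpl; [lra|intros; lia]. }
  assert (Hf : forall f, real_linear f -> (forall z, Rabs (f z) <= sabs K z) -> forall n,
    fsum n (fun k => rpow (fsum n (fun j => f (A (e j) (e k)) * f (A (e j) (e k)))) (lam / 2))
    <= C0 * rpow N lam).
  { intros f Hf Hfa n; apply (HU n (fun j k => f (A (e j) (e k))) N HN0); intros x y Hx Hy.
    rewrite <- (bilinear_trunc f p q) by assumption.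
    eapply Rle_trans; [apply Hfa|]; apply HAN; apply in_ball_trunc; assumption. }
  destruct (mixed_series (fun j k => rpow (sabs K (A (e j) (e k))) 2) (lam / 2) (C1 * rpow N lam))
    as [inner [l [Hin [Hl HlB]]]].
  - lra.
  - intros; apply rpow_ge0.
  - intros n.
    pose proof (Hf re real_linear_re abs_re_le n) as Hre.
    pose proof (Hf im real_linear_im abs_im_le n) as Him.
    apply Rle_trans with (fsum n (fun k => rpow 2 (lam / 2) *
      (rpow (fsum n (fun j => re (A (e j) (e k)) * re (A (e j) (e k)))) (lam / 2) +
       rpow (fsum n (fun j => im (A (e j) (e k)) * im (A (e j) (e k)))) (lam / 2)))).
    + apply fsum_le; intros k _.
      rewrite (fsum_ext _ _ (fun j => re (A (e j) (e k)) * re (A (e j) (e k)) +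
                                      im (A (e j) (e k)) * im (A (e j) (e k))))
        by (intros; rewrite rpow_2, sabs_sqr by apply sabs_ge0; reflexivity).
      rewrite fsum_plus; apply rpow_plus_le; [lra| |]; apply fsum_sqr_ge0.
    + rewrite fsum_scal, fsum_plus; unfold C1.
      rewrite Rmult_assoc; apply Rmult_le_compat_l; [apply rpow_ge0|lra].
  - exists inner, l; split; [exact Hin|split; [exact Hl|]].
    apply (rpow_le _ _ (/ lam)) in HlB; [|apply Rlt_le; now apply Rinv_0_lt_compat].
    rewrite rpow_mult, rpow_rpow, Rinv_r, (rpow_1r N) in HlB by (lra || apply rpow_ge0).
    nra.
Qed.

(** The identity matrix would give [n^(1/s) <= 12 |C| n^(1/lambda)], which fails for large [n]; 12
    is the 3 of [id_mat_bound] times the 4 of [matform_opnorm]. *)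
Lemma outer_exponent_optimal p q s :
  admissible p -> admissible q -> einv p + einv q < 1 -> 0 < s < hl_exp p q ->
  ~ (exists C, forall A, cont_bilinear p q A ->
       forall N, is_opnorm p q A N -> mixed_le (K := K) 2 s A (C * N)).
Proof.
  intros Hp Hq Hpq Hs [C HC].
  set (d := 1 - einv p - einv q).
  assert (Hd : 0 < / s - d).
  { unfold d; rewrite <- (Rinv_inv (1 - einv p - einv q)); fold (hl_exp p q).
    apply Rlt_0_minus, Rinv_lt_contravar; [apply Rmult_lt_0_compat|]; lra. }
  destruct (pow2_rpow_unbounded (/ s - d) (12 * Rabs C) Hd) as [m Hm].
  set (n := (2 ^ m)%nat) in *.
  assert (Hn : (0 < n)%nat) by (apply Nat.neq_0_lt_0, Nat.pow_nonzero; lia).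
  pose proof (lt_0_INR n Hn).
  destruct (matform_opnorm p q n id_mat (3 * rpow (INR n) d) Hp Hq) as [HA [N [HN HNM]]].
  { intros; apply id_mat_bound; assumption. }
  pose proof (mixed_le_matform _ _ _ _ _ (HC _ HA N HN)) as HB.
  rewrite (fsum_ext _ _ (fun _ => 1)) in HB.
  - rewrite fsum_const, Rmult_1_r in HB.
    replace (/ s) with (/ s - d + d) in HB by ring; rewrite rpow_plus in HB.
    pose proof (rpow_gt0 (INR n) d ltac:(assumption)).
    pose proof (Rle_abs C); pose proof (Rabs_pos C).
    assert (C * N <= 12 * Rabs C * rpow (INR n) d) by nra.
    nra.
  - intros k Hk; rewrite (fsum_single n k); [|assumption|].
    + unfold id_mat; rewrite Nat.eqb_refl, Rabs_R1, !rpow_1l; reflexivity.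
    + intros j _ Hj; unfold id_mat; apply Nat.eqb_neq in Hj; rewrite Hj, Rabs_R0; apply rpow_0l.
Qed.

(** Entries of modulus 1 make the left side [n^(1/r + 1/lambda)], against [8 |C| n^(1/2 + 1/lambda)]
    on the right, with 8 from 2 times 4; but [n^(1/r - 1/2)] is unbounded. *)
Lemma inner_exponent_optimal p q r :
  admissible p -> admissible q -> einv p + einv q < 1 -> 0 < r < 2 ->
  ~ (exists C, forall A, cont_bilinear p q A ->
       forall N, is_opnorm p q A N -> mixed_le (K := K) r (hl_exp p q) A (C * N)).
Proof.
  intros Hp Hq Hpq Hr [C HC].
  set (d := 1 - einv p - einv q).
  assert (Hlam : hl_exp p q = / d) by reflexivity.
  assert (Hd : 0 < d) by (unfold d; lra).
  assert (Hr2 : 0 < / r - / 2) by (apply Rlt_0_minus, Rinv_lt_contravar; lra).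
  destruct (pow2_rpow_unbounded (/ r - / 2) (8 * Rabs C) Hr2) as [m Hm].
  assert (Hn : (0 < 2 ^ m)%nat) by (apply Nat.neq_0_lt_0, Nat.pow_nonzero; lia).
  destruct (matform_opnorm p q (2 ^ m) (hadamard m) (2 * rpow (INR (2 ^ m)) (/ 2 + d)) Hp Hq)
    as [HA [N [HN HNM]]].
  { intros; apply hadamard_bound; assumption. }
  set (n := (2 ^ m)%nat) in *; pose proof (lt_0_INR n Hn).
  pose proof (mixed_le_matform _ _ _ _ _ (HC _ HA N HN)) as HB.
  rewrite Hlam, (fsum_ext _ _ (fun _ => rpow (INR n) (/ d / r))) in HB.
  - rewrite fsum_const in HB.
    rewrite <- (rpow_1r (INR n)) in HB at 1 by lra.
    rewrite <- rpow_plus, rpow_rpow in HB.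
    replace ((1 + / d / r) * / / d) with ((/ r - / 2) + (/ 2 + d)) in HB by (field; lra).
    rewrite (rpow_plus _ (/ r - / 2)) in HB.
    pose proof (rpow_gt0 (INR n) (/ 2 + d) ltac:(assumption)).
    pose proof (Rle_abs C); pose proof (Rabs_pos C).
    assert (C * N <= 8 * Rabs C * rpow (INR n) (/ 2 + d)) by nra.
    nra.
  - intros k Hk; f_equal.
    rewrite (fsum_ext _ _ (fun _ => 1)), fsum_const; [ring|].
    intros j _; rewrite hadamard_abs; apply rpow_1l.
Qed.

End Coordinates.

Theorem theorem6 (K : Scal) (HK : K = RS \/ K = CS) (p q : ext)
  (Hp : match p with Fin r => 2 <= r | Inf => True end)
  (Hq : match q with Fin r => 2 <= r | Inf => True end)
  (Hpq : einv p + einv q < 1) :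
  let lam := / (1 - einv p - einv q) in
  (exists C, 1 <= C /\
     forall A : seqK K -> seqK K -> car K, cont_bilinear p q A ->
       forall N, is_opnorm p q A N -> mixed_le 2 lam A (C * N)) /\
  (forall s, 0 < s < lam ->
     ~ (exists C, forall A : seqK K -> seqK K -> car K, cont_bilinear p q A ->
          forall N, is_opnorm p q A N -> mixed_le 2 s A (C * N))) /\
  (forall r, 0 < r < 2 ->
     ~ (exists C, forall A : seqK K -> seqK K -> car K, cont_bilinear p q A ->
          forall N, is_opnorm p q A N -> mixed_le r lam A (C * N))).
Proof.
  (* From here on both scalar fields are treated alike, through their coordinates. *)
  assert (Hcoord : exists re im inj, coordinates K re im inj).
  { destruct HK as [-> | ->]; do 3 eexists; [apply coordinates_RS|apply coordinates_CS]. }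
  destruct Hcoord as [re [im [inj Hc]]]; intros lam; split; [|split].
  - exact (hl_mixed_inequality K re im inj Hc p q Hp Hq Hpq).
  - intros s Hs; exact (outer_exponent_optimal K re im inj Hc p q s Hp Hq Hpq Hs).
  - intros r Hr; exact (inner_exponent_optimal K re im inj Hc p q r Hp Hq Hpq Hr).
Qed.
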